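(* Let $\Lambda\in\mathcal{L}$, $c\in C^0_\Lambda$, $\hat w,w\in W^c$ and $f\in\mathbb{F}[\Lambda]$. Then $$\gamma^{qp}_w\big(\pi^{qp}(\mathbf{1}^-fT_{\hat w})x^c\big)=t(w_0)^{-1}\,t(w_0(W_c))^2\,(-1)^{l(\hat w)+l(w)}\,\iota w_0\,\pi\big(T_{w_0w}\,\mathbf{1}^-_{W_c}\,T_{\hat w}^{-1}\big)\iota f .$$
   Context: Let $E$ be a Euclidean space with dual $E^*$ and $\Phi\subset E^*$ a reduced irreducible root system (in its span). For $\alpha\in\Phi$, $\alpha^\vee\in E$ is the vector with $\langle y,\alpha^\vee\rangle=2\alpha(y)/\|\alpha\|^2$ for all $y\in E$. Fix simple roots $\alpha_1,\dots,\alpha_r$ and positive roots $\Phi^+$; $W$ is the finite Weyl group, with simple reflections $s_i$, acting on $E$ by $s_\alpha(y)=y-\alpha(y)\alpha^\vee$; $l$ is the length, $w_0$ the longest element. $Q^\vee$ is the coroot lattice. $\mathcal{L}$ is the set of finitely generated abelian subgroups $\Lambda\subset E$ with $Q^\vee\subseteq\Lambda$ and $\alpha(\Lambda)\subseteq\mathbb{Z}$ for all $\alpha\in\Phi$. $\mathbb{F}$ is a field; $\mathbb{F}[E]$ is the group algebra with basis $x^y$ ($y\in E$), and $\mathbb{F}[S]$ is the span of $x^y$, $y\in S$; $W$ acts by $wx^y=x^{wy}$; $\iota$ is the linear map $x^y\mapsto x^{-y}$. $\widetilde W_\Lambda=W\ltimes\Lambda$ acts on $E$ with $\Lambda$ acting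 by translations. $\overline{C^+}=\{y\in E:0\le\alpha(y)\le1\ \forall\alpha\in\Phi^+\}$. $C^0_\Lambda$ is the set of $c\in\overline{C^+}$ whose stabilizer in $\widetilde W_\Lambda$ equals its stabilizer $W_c$ in $W$. $W_c$ is a standard parabolic subgroup with longest element $w_0(W_c)$; $W^c$ is the set of minimal length representatives of $W/W_c$. $\widetilde{\mathcal{O}}_{\Lambda,c}=\{\lambda+wc:\lambda\in\Lambda,w\in W\}$. For $c\in C^0_\Lambda$, $\mathbb{F}[\widetilde{\mathcal{O}}_{\Lambda,c}]$ is a free $\mathbb{F}[\Lambda]$-module with basis $x^{wc}$ ($w\in W^c$), and $\gamma^{qp}_w$ is defined by $f=\sum_{w\in W^c}\gamma_w^{qp}(f)x^{wc}$. Fix a $W$-invariant map $\Phi\to\mathbb{F}^\times$, $\alpha\mapsto t_\alpha$; $t_j=t_{\alpha_j}$, and $t(w)=t_{j_1}\cdots t_{j_k}$ for a reduced expression $w=s_{j_1}\cdots s_{j_k}$. For $f\in\mathbb{F}[\Lambda]$, $\nabla_j(f)=\frac{s_jf-f}{x^{\alpha_j^\vee}-1}$. The extended affine Hecke algebra $\widetilde{\mathcal{H}}_\Lambda$ is generated by $T_1,\dots,T_r$ and $x^\lambda$ ($\lambda\in\Lambda$) with: braid relations; $(T_j-t_j)(T_j+t_j^{-1})=0$; $x^\lambda x^\mu=x^{\lambda+\mu}$, $x^0=1$; $T_jx^\lambda-x^{s_j\lambda}T_j=(t_j-t_j^{-1})\nabla_j(x^\lambda)$. $T_w=T_{j_1}\cdots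 T_{j_k}$ for a reduced expression. $\mathbf{1}^-=\sum_{w\in W}(-1)^{l(w)}t(w)^{-1}T_w$ and $\mathbf{1}^-_{W_c}=\sum_{w\in W_c}(-1)^{l(w)}t(w)^{-1}T_w$. Polynomial representation $\pi$ on $\mathbb{F}[\Lambda]$: $\pi(T_j)f=t_js_jf+(t_j-t_j^{-1})\nabla_j(f)$, $\pi(x^\mu)$ multiplication by $x^\mu$. Quasi-polynomial representation $\pi^{qp}$ on $\mathbb{F}[E]$ (preserving $\mathbb{F}[\widetilde{\mathcal{O}}_{\Lambda,c}]$): $\pi^{qp}(x^\lambda)x^y=x^{\lambda+y}$ and $\pi^{qp}(T_j)x^y=\chi_j(\alpha_j(y))x^{s_jy}+(t_j-t_j^{-1})\frac{x^{y-\lfloor\alpha_j(y)\rfloor\alpha_j^\vee}-x^y}{x^{\alpha_j^\vee}-1}$, where $\chi_j(a)=t_j$ if $a\in\mathbb{Z}$ and $\chi_j(a)=1$ otherwise. *)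

(* Defs.v *)
From HB Require Import structures.
From mathcomp Require Import all_boot all_order all_algebra.
From mathcomp Require Import finmap.
From mathcomp Require Import mathcomp_extra boolp classical_sets functions.
From mathcomp Require Import cardinality fsbigop reals.
From mathcomp Require Import monalg.

Set Implicit Arguments.
Unset Strict Implicit.
Unset Printing Implicit Defensive.

Import Order.TTheory GRing.Theory Num.Theory.

Local Open Scope classical_set_scope.
Local Open Scope ring_scope.

Section RootSystem.
Context (R : realType) (E : vectType R) (dot : {dot E for idfun}).
Implicit Types (a b : 'Hom(E, R^o)) (Phi : set 'Hom(E, R^o)) (w : 'End(E)).

(* the vector representing a; it exists and is unique in finite dimension *)
Definition riesz a : E := xget 0 [set v | forall y, a y = dot y v].
Definition dual_dot a b : R := dot (riesz a) (riesz b).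
Definition coroot a : E := riesz ((2 / dual_dot a a) *: a).
Definition refl a : 'End(E) := linfun (fun y => y - a y *: coroot a).

Definition root_system Phi : Prop :=
  [/\ finite_set Phi, ~ Phi 0,
      forall a b, Phi a -> Phi b -> Phi (b - b (coroot a) *: a)
    & forall a b, Phi a -> Phi b -> b (coroot a) \is a Num.int].

Definition reduced_rs Phi : Prop :=
  forall a (k : R), Phi a -> Phi (k *: a) -> k = 1 \/ k = -1.

Definition irreducible_rs Phi : Prop :=
  Phi !=set0 /\
  forall A B : set 'Hom(E, R^o), Phi = A `|` B ->
    (forall a b, A a -> B b -> dual_dot a b = 0) -> A = set0 \/ B = set0.

Definition pos_roots Phi r (alpha : 'I_r -> 'Hom(E, R^o)) :
    set 'Hom(E, R^o) :=
  [set b | Phi b /\ exists k : 'I_r -> nat, b = \sum_i alpha i *+ k i].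

Definition simple_roots Phi r (alpha : 'I_r -> 'Hom(E, R^o)) : Prop :=
  [/\ forall i, Phi (alpha i), free [seq alpha i | i : 'I_r]
    & forall b, Phi b -> pos_roots Phi alpha b \/ pos_roots Phi alpha (- b)].

Definition comps (s : seq 'End(E)) : 'End(E) :=
  foldr (fun u v => (u \o v)%VF) \1%VF s.

Definition weyl Phi : set 'End(E) :=
  [set w | exists2 s : seq 'Hom(E, R^o),
     {in s, forall a, Phi a} & w = comps [seq refl a | a <- s]].

Definition zspan (A : set E) : set E :=
  [set y | exists n (v : 'I_n -> E) (m : 'I_n -> int),
     (forall i, A (v i)) /\ y = \sum_i v i *~ m i].

Definition coroot_lattice Phi : set E := zspan (coroot @` Phi).

Definition admissible_lattice Phi (Lambda : set E) : Prop :=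
  [/\ exists2 A : set E, finite_set A & Lambda = zspan A,
      coroot_lattice Phi `<=` Lambda
    & forall a y, Phi a -> Lambda y -> a y \is a Num.int].

Section Length.
Context (r : nat) (alpha : 'I_r -> 'Hom(E, R^o)).

Definition word (s : seq 'I_r) : 'End(E) :=
  comps [seq refl (alpha j) | j <- s].

Definition reduced_expr w (s : seq 'I_r) : Prop :=
  word s = w /\ forall s', word s' = w -> (size s <= size s')%N.

(* A chosen reduced expression; t(w) and T_w do not depend on the choice, by
   Matsumoto's theorem. *)
Definition rex w : seq 'I_r := xget [::] [set s | reduced_expr w s].

Definition len w : nat := size (rex w).

Definition longest (P : set 'End(E)) : 'End(E) :=
  xget \1%VF [set w | P w /\ forall u, P u -> (len u <= len w)%N].

Definition stab Phi (c : E) : set 'End(E) := [set w | weyl Phi w /\ w c = c].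

Definition min_reps Phi (c : E) : set 'End(E) :=
  [set w | weyl Phi w /\
     forall u, stab Phi c u -> (len w <= len (w \o u)%VF)%N].

Definition closed_alcove Phi : set E :=
  [set y | forall a, pos_roots Phi alpha a -> 0 <= a y <= 1].

(* The pair (w, v) stands for the affine map y |-> w y + v. *)
Definition C0 Phi (Lambda : set E) : set E :=
  [set c | closed_alcove Phi c /\
     [set p : 'End(E) * E | [/\ weyl Phi p.1, Lambda p.2 & p.1 c + p.2 = c]] =
     [set p : 'End(E) * E | stab Phi c p.1 /\ p.2 = 0]].

End Length.
End RootSystem.

Section GroupAlgebra.
Context (R : realType) (E : vectType R) (F : fieldType).
Implicit Types (f g : {malg F[E]}) (w : 'End(E)).

(* {malg F[E]} is the space of finitely supported functions E -> F, and << y >>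
   is its basis vector x^y.  The ring structure of monalg is unavailable, as it
   requires a monoid of exponents in which 0 is the only unit. *)
Definition lin_ext (b : E -> {malg F[E]}) f : {malg F[E]} :=
  \sum_(y <- msupp f) f@_y *: b y.

Definition gmul f g : {malg F[E]} :=
  lin_ext (fun y => lin_ext (fun z => << (y + z) >>) g) f.

(* F[E] is an integral domain, so that the quotient is unique for d <> 0. *)
Definition gdiv h d : {malg F[E]} := xget 0 [set g | gmul g d = h].

Definition supported (S : set E) : set {malg F[E]} :=
  [set f | {in msupp f, forall y, S y}].

Definition wact w f : {malg F[E]} := lin_ext (fun y => << (w y) >>) f.

Definition iota_inv f : {malg F[E]} := lin_ext (fun y => << (- y) >>) f.

End GroupAlgebra.

Section Hecke.
Context (R : realType) (E : vectType R) (dot : {dot E for idfun}).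
Context (Phi : set 'Hom(E, R^o)) (r : nat) (alpha : 'I_r -> 'Hom(E, R^o)).
Context (F : fieldType) (t : 'Hom(E, R^o) -> F) (Lambda : set E).
Implicit Types (w : 'End(E)) (f : {malg F[E]}) (j : 'I_r).

(* w acts on linear forms by a |-> a \o w^-1. *)
Definition W_invariant : Prop :=
  (forall a, Phi a -> t a != 0) /\
  (forall w a, weyl dot Phi w -> Phi a -> t (a \o w)%VF = t a).

Definition tw w : F := \prod_(j <- rex dot alpha w) t (alpha j).

Definition cor j : E := coroot dot (alpha j).
Definition srefl j : 'End(E) := refl dot (alpha j).

(* x^(coroot of alpha j) - 1 *)
Definition den j : {malg F[E]} := << (cor j) >> - << (0 : E) >>.

Definition nabla j f : {malg F[E]} := gdiv (wact (srefl j) f - f) (den j).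

Section Presentation.
Context (A : algType F) (T : 'I_r -> A) (X : E -> A).

Definition embed f : A := \sum_(y <- msupp f) f@_y *: X y.

Definition end_order (u : 'End(E)) (m : nat) : Prop :=
  [/\ (0 < m)%N, comps (nseq m u) = \1%VF
    & forall k, (0 < k)%N -> comps (nseq k u) = \1%VF -> (m <= k)%N].

Definition braid_word i j (m : nat) : seq 'I_r :=
  mkseq (fun k => if odd k then j else i) m.

Definition hecke_relations : Prop :=
  [/\ forall i j m, end_order (srefl i \o srefl j)%VF m ->
        \prod_(k <- braid_word i j m) T k = \prod_(k <- braid_word j i m) T k,
      forall j, (T j - (t (alpha j))%:A) * (T j + (t (alpha j))^-1%:A) = 0,
      forall y z, Lambda y -> Lambda z -> X y * X z = X (y + z),
      X 0 = 1
    & forall j y, Lambda y ->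
        T j * X y - X (srefl j y) * T j =
        (t (alpha j) - (t (alpha j))^-1) *: embed (nabla j << y >>)].

Definition Tw w : A := \prod_(j <- rex dot alpha w) T j.

Definition antisym (P : set 'End(E)) : A :=
  \sum_(w \in P) ((-1) ^+ len dot alpha w * (tw w)^-1) *: Tw w.

End Presentation.

(* H, with its elements T j and X y (y in Lambda), is the algebra presented by
   the Hecke relations.  The values of X outside Lambda play no role. *)
Definition ext_affine_hecke (H : algType F) (T : 'I_r -> H) (X : E -> H) :
    Prop :=
  hecke_relations T X /\
  forall (A : algType F) (T' : 'I_r -> A) (X' : E -> A),
    hecke_relations T' X' ->
    let extends (phi : H -> A) :=
      (forall j, phi (T j) = T' j) /\
      (forall y, Lambda y -> phi (X y) = X' y) in
    exists phi : {lrmorphism H -> A}, extends phi /\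
      forall psi : {lrmorphism H -> A}, extends psi -> psi =1 phi.

(* rho makes the subspace M of F[E] a left module over the F-algebra H. *)
Definition representation (H : algType F) (M : set {malg F[E]})
    (rho : H -> {malg F[E]} -> {malg F[E]}) : Prop :=
  [/\ forall h f, M f -> M (rho h f),
      forall h k f g, M f -> M g -> rho h (k *: f + g) = k *: rho h f + rho h g,
      forall k h h' f, M f -> rho (k *: h + h') f = k *: rho h f + rho h' f,
      forall f, M f -> rho 1 f = f
    & forall h h' f, M f -> rho (h * h') f = rho h (rho h' f)].

Definition polynomial_rep (H : algType F) (T : 'I_r -> H) (X : E -> H)
    (pi : H -> {malg F[E]} -> {malg F[E]}) : Prop :=
  [/\ representation (supported Lambda) pi,
      forall y f, Lambda y -> supported Lambda f ->
        pi (X y) f = gmul << y >> f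
    & forall j f, supported Lambda f ->
        pi (T j) f = t (alpha j) *: wact (srefl j) f +
                     (t (alpha j) - (t (alpha j))^-1) *: nabla j f].

Definition chi j (a : R) : F := if a \is a Num.int then t (alpha j) else 1.

Definition quasi_polynomial_rep (H : algType F) (T : 'I_r -> H) (X : E -> H)
    (piqp : H -> {malg F[E]} -> {malg F[E]}) : Prop :=
  [/\ representation setT piqp,
      forall l y, Lambda l -> piqp (X l) << y >> = << (l + y) >>
    & forall j y,
        piqp (T j) << y >> =
          chi j (alpha j y) *: << (srefl j y) >> +
          (t (alpha j) - (t (alpha j))^-1) *:
            gdiv (<< (y - cor j *~ Num.floor (alpha j y : R)) >> - << y >>)
                 (den j)].

(* the coefficients in F[Lambda] of f on the x^(w c), for w in W^c *)
Definition gamma_decomposition (c : E) f (g : 'End(E) -> {malg F[E]}) : Prop :=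
  (forall w, min_reps dot alpha Phi c w -> supported Lambda (g w)) /\
  f = \sum_(w \in min_reps dot alpha Phi c) gmul (g w) << (w c) >>.

Definition gamma (c : E) f : 'End(E) -> {malg F[E]} :=
  xget (fun=> 0) [set g | gamma_decomposition c f g].

End Hecke.

(* Main.v *)
Require Import Defs.
From HB Require Import structures.
From mathcomp Require Import all_boot all_order all_algebra.
From mathcomp Require Import finmap.
From mathcomp Require Import mathcomp_extra boolp classical_sets functions.
From mathcomp Require Import cardinality fsbigop reals.
From mathcomp Require Import monalg ring zify.

Set Implicit Arguments.
Unset Strict Implicit.
Unset Printing Implicit Defensive.

Import Order.TTheory GRing.Theory Num.Theory.

Local Open Scope classical_set_scope.
Local Open Scope ring_scope.

(* Expand [1^- f = sum_w g_w T_w] with [g_w] in F[Lambda].  Since [T_j 1^- =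
   - t_j^-1 1^-], comparing coefficients gives [g_w = - pi(T_j) g_(s_j w)]
   whenever [s_j w] is longer than [w].  The expansion of [T_w f] is triangular,
   so [g_(w0)] is known, and conjugating [pi(T_j)] by [iota w0] gives
   [g_w = (-1)^l(w) t(w0)^-1 iota w0 pi(T_(w0 w)) iota f].  Coefficients can be
   compared because the elements act on [x^c0], where [c0] is a point of the
   alcove with trivial stabilizer: there [T_w x^c0 = x^(w c0)].
   Multiplying on the right by [T_j] amounts, up to sign, to inserting
   [T_j^-1] on the right of [T_(w0 w)]; this accounts for [T_w'].
   Finally [T_(w v) x^c = t(v) x^(w c)] for [w] in W^c and [v] in W_c, and
   [T_(w0 w v) = T_(w0 w) (T_(v^-1))^-1], so the coefficient of [x^(w c)]
   involves [sum_v (-1)^l(v) t(v) (T_(v^-1))^-1 = t(w0(W_c))^2 1^-_(W_c)]. *)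

(** * The group algebra *)

(** Put [h] for 1^- f. The recursion is the coefficient of T_(s_j w) in T_j h = - t_j^-1 h: the
    cross relation produces s_j g_w, s_j g_(s_j w) and nabla_j g_(s_j w). After s_j is applied, the
    identity s_j nabla_j g = nabla_j g + (s_j g - g) reassembles the last two terms into pi(T_j)
    g_(s_j w). Conjugation by w0 alone does not preserve the operators pi(T_j), because it inverts
    the exponents in the denominators x^a - 1; [iota] restores the sign, and pi(T_k) becomes pi(T_j)
    with s_j = w0 s_k w0. So descending from w0 in the recursion amounts to building T_(w0 w) up
    from the identity. Left multiplication by w0 exchanges right descents and right ascents. This is
    why T_j to the right of T_w is matched by T_j^-1 to the right of T_(w0 w), and why the lengths
    of w and v add while that of v is subtracted from that of w0 w. All length comparisons are made
    through signs of roots at the orbit of one regular vector [rho]. *)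

Section GroupAlgebraTheory.
Context (R : realType) (E : vectType R) (F : fieldType).
Implicit Types (f g h : {malg F[E]}) (w : 'End(E)) (S : set E) (y z : E).

(** The supports of f, g and a f + g differ, so all three sums are first widened to a common finite
    set. The target is an arbitrary module, so that both [lin_ext] and [embed] are covered. *)
Lemma supp_sumZ_linear (L : lmodType F) (b : E -> L) :
  linear (fun f => \sum_(y <- msupp f) f@_y *: b y).
Proof.
have widen (d : {fset E}) f : (msupp f `<=` d)%fset ->
    \sum_(y <- msupp f) f@_y *: b y = \sum_(y <- d) f@_y *: b y.
  move=> fd; apply: big_fset_incl => // y _ /mcoeff_outdom ->.
  by rewrite scale0r.
move=> a f g.
pose d := (msupp f `|` msupp g `|` msupp (a *: f + g))%fset.
rewrite (widen d f) ?(widen d g) ?(widen d (_ + _)); last 3 first.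
- exact: fsubsetUr.
- exact: fsubset_trans (fsubsetUr _ _) (fsubsetUl _ _).
- exact: fsubset_trans (fsubsetUl _ _) (fsubsetUl _ _).
rewrite scaler_sumr -big_split; apply: eq_bigr => y _.
by rewrite mcoeffD mcoeffZ scalerDl scalerA.
Qed.

Lemma supp_sumZ_basis (L : lmodType F) (b : E -> L) y :
  \sum_(z <- msupp (<< y >> : {malg F[E]}))
    (<< y >> : {malg F[E]})@_z *: b z = b y.
Proof. by rewrite msuppU oner_eq0 big_seq_fset1 mcoeffUU scale1r. Qed.

HB.instance Definition _ b := GRing.isLinear.Build F {malg F[E]} {malg F[E]}
  *:%R (lin_ext b) (supp_sumZ_linear b).

HB.instance Definition _ (A : algType F) (X : E -> A) :=
  GRing.isLinear.Build F {malg F[E]} A *:%R (embed X) (supp_sumZ_linear X).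

Lemma lin_ext_basis b y : lin_ext b << y >> = b y :> {malg F[E]}.
Proof. exact: supp_sumZ_basis. Qed.

Lemma embed_basis (A : algType F) (X : E -> A) y :
  embed X (<< y >> : {malg F[E]}) = X y.
Proof. exact: supp_sumZ_basis. Qed.

Lemma malg_basis f : f = \sum_(y <- msupp f) f@_y *: << y >>.
Proof.
rewrite {1}[f]monalgE; apply: eq_bigr => y _; apply/malgP => z.
by rewrite mcoeffZ !mcoeffU mulr_natr.
Qed.

Lemma supportedP S f : supported S f <-> forall y, f@_y != 0 -> S y.
Proof.
by split=> [Sf y|Sf y]; rewrite ?mcoeff_neq0 => y_f; apply: Sf;
  rewrite ?mcoeff_neq0.
Qed.

(** The inductive step keeps [supported S f] at hand because [pi] and [nabla] are linear only on
    F[Lambda]. *)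
Lemma supported_ind S (P : {malg F[E]} -> Prop) :
  P 0 ->
  (forall a y f, S y -> supported S f -> P f -> P (a *: << y >> + f)) ->
  forall f, supported S f -> P f.
Proof.
move=> P0 PD f Sf; rewrite [f]malg_basis.
have : {in enum_fset (msupp f), forall y, S y} by [].
elim: (enum_fset _) => [|y s IH Ss]; first by rewrite big_nil.
rewrite big_cons.
have {IH}: supported S (\sum_(y0 <- s) f@_y0 *: << y0 >>) /\
           P (\sum_(y0 <- s) f@_y0 *: << y0 >>).
  split; last by apply: IH => z zs; apply: Ss; rewrite inE zs orbT.
  apply/supportedP => z; rewrite raddf_sum /= => nz.
  apply: contrapT => nSz; move: nz; rewrite big_seq big1 ?eqxx// => u us.
  rewrite mcoeffZ mcoeffU; have [uz|] := eqVneq u z; last by rewrite mulr0.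
  by case: nSz; rewrite -uz; apply: Ss; rewrite inE us orbT.
by case=> ? ?; apply: PD => //; apply: Ss; rewrite inE eqxx.
Qed.

Lemma linear_eq_supported S (L : lmodType F) (p q : {linear {malg F[E]} -> L}) :
  (forall y, S y -> p << y >> = q << y >>) ->
  forall f, supported S f -> p f = q f.
Proof.
move=> pq; apply: supported_ind => [|a y f Sy _ IH]; first by rewrite !linear0.
by rewrite !linearP pq// IH.
Qed.

Lemma supportedT f : supported setT f. Proof. by []. Qed.

Lemma linear_eq_basis (L : lmodType F) (p q : {linear {malg F[E]} -> L}) :
  (forall y, p << y >> = q << y >>) -> p =1 q.
Proof. by move=> pq f; apply: (@linear_eq_supported setT). Qed.

Lemma supported0 S : supported S (0 : {malg F[E]}).
Proof. by apply/supportedP => y; rewrite mcoeff0 eqxx. Qed.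

Lemma supportedD S f g : supported S f -> supported S g -> supported S (f + g).
Proof.
move=> /supportedP Sf /supportedP Sg; apply/supportedP => y; rewrite mcoeffD.
have [->|/Sf//] := eqVneq f@_y 0; rewrite add0r; exact: Sg.
Qed.

Lemma supportedZ S a f : supported S f -> supported S (a *: f).
Proof.
move=> /supportedP Sf; apply/supportedP => y; rewrite mcoeffZ.
by rewrite mulf_eq0 negb_or => /andP[_ /Sf].
Qed.

Lemma supportedN S f : supported S f -> supported S (- f).
Proof. by move=> Sf; rewrite -scaleN1r; apply: supportedZ. Qed.

Lemma supportedB S f g : supported S f -> supported S g -> supported S (f - g).
Proof. by move=> Sf Sg; apply: supportedD => //; apply: supportedN. Qed.

Lemma supported_basis S y : S y -> supported S (<< y >> : {malg F[E]}).
Proof. by move=> Sy z; rewrite msuppU oner_eq0 inE => /eqP ->. Qed.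

Lemma supported_sum (I : eqType) (s : seq I) S (h : I -> {malg F[E]}) :
  {in s, forall i, supported S (h i)} -> supported S (\sum_(i <- s) h i).
Proof.
move=> Sh; rewrite big_seq; elim/big_ind: _ => //; first exact: supported0.
exact: supportedD.
Qed.

Lemma supported_lin_ext S S' (b : E -> {malg F[E]}) f :
  (forall y, S y -> supported S' (b y)) -> supported S f ->
  supported S' (lin_ext b f).
Proof.
by move=> Sb Sf; apply: supported_sum => y /Sf/Sb; apply: supportedZ.
Qed.

Lemma gmul_linear f : linear (gmul f).
Proof.
move=> a g h; rewrite /gmul scaler_sumr -big_split; apply: eq_bigr => y _ /=.
by rewrite linearP scalerDr !scalerA mulrC.
Qed.

HB.instance Definition _ f := GRing.isLinear.Build F {malg F[E]} {malg F[E]}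
  *:%R (gmul f) (gmul_linear f).

(** Swaps the arguments of [gmul], so that linearity in the first variable can be carried by a
    canonical structure of its own. *)
Definition gmulr g f := gmul f g.

Lemma gmulr_linear g : linear (gmulr g).
Proof. by move=> a f h; rewrite /gmulr /gmul linearP. Qed.

HB.instance Definition _ g := GRing.isLinear.Build F {malg F[E]} {malg F[E]}
  *:%R (gmulr g) (gmulr_linear g).

Lemma gmulDl f g h : gmul (f + g) h = gmul f h + gmul g h.
Proof. exact: (linearD (gmulr h)). Qed.

Lemma gmulBl f g h : gmul (f - g) h = gmul f h - gmul g h.
Proof. exact: (linearB (gmulr h)). Qed.

Lemma gmulNl f h : gmul (- f) h = - gmul f h.
Proof. exact: (linearN (gmulr h)). Qed.

Lemma gmulZl a f h : gmul (a *: f) h = a *: gmul f h.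
Proof. exact: (linearZZ (gmulr h)). Qed.

Lemma gmul0l h : gmul 0 h = 0. Proof. exact: (linear0 (gmulr h)). Qed.

Lemma gmul_basis y z : gmul << y >> << z >> = << (y + z) >> :> {malg F[E]}.
Proof. by rewrite /gmul !lin_ext_basis. Qed.

Lemma gmulC f g : gmul f g = gmul g f.
Proof.
apply: (linear_eq_basis (p := gmulr g) (q := gmul g)) => y; rewrite /= /gmulr.
apply: (linear_eq_basis (q := gmulr << y >>)) => z; rewrite /= /gmulr.
by rewrite !gmul_basis addrC.
Qed.

Lemma gmulA f g h : gmul f (gmul g h) = gmul (gmul f g) h.
Proof.
apply: (linear_eq_basis (p := gmulr (gmul g h)) (q := gmulr h \o gmulr g)) => y.
rewrite /= /gmulr.
apply: (linear_eq_basis (p := gmul << y >> \o gmulr h)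
  (q := gmulr h \o gmul << y >>)) => z; rewrite /= /gmulr.
apply: (linear_eq_basis (p := gmul << y >> \o gmul << z >>)
  (q := gmul (gmul << y >> << z >>))) => u; rewrite /= /gmulr.
by rewrite !gmul_basis addrA.
Qed.

Lemma gmul_unitl f : gmul << 0 >> f = f.
Proof.
apply: (linear_eq_basis (q := idfun)) => y; rewrite /= /gmulr.
by rewrite gmul_basis add0r.
Qed.

Lemma mcoeff_gmul_basis f y z : (gmul f << y >>)@_z = f@_(z - y).
Proof.
move: f (@supportedT f); apply: supported_ind.
  by rewrite gmul0l !mcoeff0.
move=> a u f _ _ IH; rewrite gmulDl gmulZl gmul_basis !mcoeffD !mcoeffZ IH.
by rewrite !mcoeffU [u + y == z]eq_sym -subr_eq [z - y == u]eq_sym.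
Qed.

Lemma wact_basis w y : wact w << y >> = << (w y) >> :> {malg F[E]}.
Proof. exact: lin_ext_basis. Qed.

HB.instance Definition _ w := GRing.isLinear.Build F {malg F[E]} {malg F[E]}
  *:%R (wact w) (supp_sumZ_linear (fun y => << (w y) >>)).

HB.instance Definition _ := GRing.isLinear.Build F {malg F[E]} {malg F[E]}
  *:%R (@iota_inv R E F) (supp_sumZ_linear (fun y => << (- y) >>)).

Lemma iota_inv_basis y : iota_inv << y >> = << (- y) >> :> {malg F[E]}.
Proof. exact: lin_ext_basis. Qed.

Lemma wact_comp w w' f : wact w (wact w' f) = wact (w \o w')%VF f.
Proof.
apply: (linear_eq_basis (p := wact w \o wact w')) => y; rewrite /= /gmulr.
by rewrite !wact_basis comp_lfunE.
Qed.

Lemma wact_id f : wact \1%VF f = f.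
Proof.
apply: (linear_eq_basis (p := wact \1%VF) (q := idfun)) => y /=.
by rewrite wact_basis id_lfunE.
Qed.

Lemma wact_gmul w f g : wact w (gmul f g) = gmul (wact w f) (wact w g).
Proof.
apply: (linear_eq_basis (p := wact w \o gmulr g)
  (q := gmulr (wact w g) \o wact w)) => y; rewrite /= /gmulr.
apply: (linear_eq_basis (p := wact w \o gmul << y >>)
  (q := gmul (wact w << y >>) \o wact w)) => z; rewrite /= /gmulr.
by rewrite gmul_basis !wact_basis gmul_basis linearD.
Qed.

Lemma iota_gmul f g : iota_inv (gmul f g) = gmul (iota_inv f) (iota_inv g).
Proof.
apply: (linear_eq_basis (p := @iota_inv R E F \o gmulr g)
  (q := gmulr (iota_inv g) \o @iota_inv R E F)) => y; rewrite /= /gmulr.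
apply: (linear_eq_basis (p := @iota_inv R E F \o gmul << y >>)
  (q := gmul (iota_inv << y >>) \o @iota_inv R E F)) => z; rewrite /= /gmulr.
by rewrite gmul_basis !iota_inv_basis gmul_basis opprD.
Qed.

Lemma iota_wact w f : iota_inv (wact w f) = wact w (iota_inv f).
Proof.
apply: (linear_eq_basis (p := @iota_inv R E F \o wact w)
  (q := wact w \o @iota_inv R E F)) => y; rewrite /= /gmulr.
by rewrite iota_inv_basis !wact_basis iota_inv_basis linearN.
Qed.

Lemma iota_invK f : iota_inv (iota_inv f) = f.
Proof.
apply: (linear_eq_basis (p := @iota_inv R E F \o @iota_inv R E F)
  (q := idfun)) => y; rewrite /= /gmulr.
by rewrite !iota_inv_basis opprK.
Qed.

Lemma supported_wact S w f : (forall y, S y -> S (w y)) ->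
  supported S f -> supported S (wact w f).
Proof.
move=> Sw; apply: supported_lin_ext => y Sy.
by apply: supported_basis; apply: Sw.
Qed.

Lemma supported_iota S f : (forall y, S y -> S (- y)) ->
  supported S f -> supported S (iota_inv f).
Proof.
move=> SN; apply: supported_lin_ext => y Sy.
by apply: supported_basis; apply: SN.
Qed.

(* [f x^u = f] would make the finite support of [f] stable under translation
   by [u]. *)
Lemma gmul_den_inj f u : u != 0 -> gmul f (<< u >> - << 0 >>) = 0 -> f = 0.
Proof.
move=> u0 /eqP; rewrite linearB subr_eq0 /= => /eqP fu.
have shift y n : f@_y = f@_(y - u *+ n).
  elim: n => [|n IH]; first by rewrite mulr0n subr0.
  rewrite mulrSr opprD addrA -mcoeff_gmul_basis fu mcoeff_gmul_basis subr0.
  exact: IH.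
apply/malgP => y; rewrite mcoeff0; apply/eqP; apply: contraT => fy.
have inj : injective (fun n => y - u *+ n).
  move=> m n /addrI/oppr_inj /eqP; rewrite -!scaler_nat -subr_eq0 -scalerBl.
  by rewrite scaler_eq0 (negPf u0) orbF subr_eq0 eqr_nat => /eqP.
(* One more translate of y than the support has elements; all are distinct and all would lie in the
   support. *)
pose s := [seq y - u *+ n | n <- iota 0 (size (enum_fset (msupp f))).+1].
have : (size s <= size (enum_fset (msupp f)))%N.
  apply: uniq_leq_size; first by rewrite map_inj_uniq ?iota_uniq.
  by move=> z /mapP[n _ ->]; rewrite -[_ \in _]mcoeff_neq0 -shift.
by rewrite size_map size_iota ltnn.
Qed.

Lemma gdivP f h u : u != 0 -> gmul f (<< u >> - << 0 >>) = h ->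
  gdiv h (<< u >> - << 0 >>) = f.
Proof.
move=> u0 fh; apply: xget_unique => // g gh; apply/eqP; rewrite -subr_eq0.
by apply/eqP; apply: (gmul_den_inj u0); rewrite gmulBl gh fh subrr.
Qed.

(** The points b i lie in distinct cosets of S, so the summands have disjoint supports: only the
    i-th one contributes to the coefficient at y + b i. *)
Lemma coset_free (I : choiceType) (P : set I) (S : set E) (b : I -> E)
    (g : I -> {malg F[E]}) :
  (forall y z, S y -> S z -> S (y - z)) -> finite_set P ->
  (forall i j, P i -> P j -> S (b i - b j) -> i = j) ->
  (forall i, P i -> supported S (g i)) ->
  \sum_(i \in P) gmul (g i) << (b i) >> = 0 ->
  forall i, P i -> g i = 0.
Proof.
move=> SB Pfin disj Sg sum0 i Pi; apply/malgP => y; rewrite mcoeff0.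
have S0 : forall z, S z -> S 0 by move=> z Sz; rewrite -(subrr z); apply: SB.
have [//|/eqP gy] := eqVneq (g i)@_y 0.
have Sy : S y by move/supportedP: (Sg i Pi); apply; apply/eqP.
have := congr1 (mcoeff (y + b i)) sum0; rewrite mcoeff0 fsbig_finite//.
rewrite raddf_sum /= (bigD1_seq i) ?in_fset_set ?fset_uniq ?inE//=.
rewrite big_seq_cond big1 ?addr0 => [|j /andP[]].
  by rewrite mcoeff_gmul_basis addrK.
rewrite in_fset_set// inE => Pj ji; rewrite mcoeff_gmul_basis.
apply/eqP; apply: contraNT ji => nz; apply/eqP; apply/esym/disj => //.
move/supportedP: (Sg j Pj) => /(_ _ nz) Sz.
by have := SB _ _ Sz Sy; rewrite addrAC [y + _]addrC addrK.
Qed.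

End GroupAlgebraTheory.

(** * Reflections and Weyl groups *)

Section Euclidean.
Context (R : realType) (E : vectType R) (dot : {dot E for idfun}).
Implicit Types (a b : 'Hom(E, R^o)) (w u v : 'End(E)) (x y z : E).

Lemma dotC x y : dot x y = dot y x.
Proof. by rewrite hermC expr0 mul1r. Qed.

Lemma dot_gt0 x : x != 0 -> 0 < dot x x. Proof. exact: neq0_dnorm_gt0. Qed.

Lemma dotBr x y z : dot x (y - z) = dot x y - dot x z.
Proof. exact: linearBr. Qed.

Lemma dotBl x y z : dot (x - y) z = dot x z - dot y z.
Proof. by rewrite dotC dotBr !(dotC z). Qed.

Lemma dotZr k x y : dot x (k *: y) = k * dot x y.
Proof. exact: linearZr_LR. Qed.

Lemma dotZl k x y : dot (k *: x) y = k * dot x y.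
Proof. by rewrite dotC dotZr (dotC y). Qed.

Lemma dotDl x y z : dot (x + y) z = dot x z + dot y z.
Proof. by have := dotBl (x + y) y z; rewrite addrK => ->; rewrite subrK. Qed.

Lemma dotDr x y z : dot x (y + z) = dot x y + dot x z.
Proof. by rewrite dotC dotDl !(dotC _ x). Qed.

Lemma dot_ext x y : (forall z, dot z x = dot z y) -> x = y.
Proof.
move=> xy; apply/eqP; rewrite -subr_eq0; apply: contraT => /dot_gt0.
by rewrite dotBr xy subrr ltxx.
Qed.

Definition dotr x y : R^o := dot y x.

Lemma dotr_linear x : linear (dotr x).
Proof. by move=> k y z; rewrite /dotr dotDl dotZl. Qed.

HB.instance Definition _ x := GRing.isLinear.Build R E R^o *:%R
  (dotr x) (dotr_linear x).

Definition dot_form x : 'Hom(E, R^o) := linfun (dotr x).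

Lemma dot_formE x y : dot_form x y = dot y x. Proof. exact: lfunE. Qed.

Lemma dot_form_linear : linear dot_form.
Proof.
move=> k x y; apply/lfunP => z; rewrite add_lfunE scale_lfunE !dot_formE.
by rewrite dotDr dotZr.
Qed.

HB.instance Definition _ := GRing.isLinear.Build R E 'Hom(E, R^o) *:%R
  dot_form dot_form_linear.

(** [dot_form] is injective because the scalar product is definite, and E has the dimension of its
    dual. *)
Lemma dot_form_surj a : exists x, a = dot_form x.
Proof.
pose h := linfun dot_form.
have kerh : lker h == 0%VS.
  apply/lker0P => x y; rewrite !lfunE /= => xy.
  by apply: dot_ext => z; rewrite -!dot_formE xy.
have imh : limg h = fullv.
  apply/eqP; rewrite eqEdim subvf limg_dim_eq ?(eqP kerh) ?capv0 // !dimvf.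
  by rewrite /dim /= muln1.
have : a \in limg h by rewrite imh memvf.
by case/memv_imgP => x _ ->; exists x; rewrite lfunE.
Qed.

Lemma rieszE a y : a y = dot y (riesz dot a).
Proof.
have [x ax] := dot_form_surj a.
apply: (@xgetPex _ 0 [set v | forall y, a y = dot y v]).
by exists x => z; rewrite ax dot_formE.
Qed.

Lemma riesz_unique a x : (forall y, a y = dot y x) -> riesz dot a = x.
Proof. by move=> ax; apply: dot_ext => z; rewrite -ax rieszE. Qed.

Lemma rieszZ k a : riesz dot (k *: a) = k *: riesz dot a.
Proof.
by apply: riesz_unique => y; rewrite scale_lfunE rieszE dotZr.
Qed.

Lemma formZ a k x : a (k *: x) = k * a x.
Proof. exact: linearZ. Qed.

Lemma form_subZ a k x y : a (x - k *: y) = a x - k * a y.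
Proof. by rewrite linearB; congr (_ - _); exact: linearZ. Qed.

Lemma endo_subZ w k x y : w (x - k *: y) = w x - k *: w y.
Proof. by rewrite linearB; congr (_ - _); exact: linearZ. Qed.

Lemma riesz_eq0 a : riesz dot a = 0 -> a = 0.
Proof.
move=> a0; apply/lfunP => y; rewrite rieszE a0 zero_lfunE.
by rewrite -(scale0r 0) dotZr mul0r.
Qed.

Lemma dual_dot_gt0 a : a <> 0 -> 0 < dual_dot dot a a.
Proof. by move=> a0; apply: dot_gt0; apply/eqP => /riesz_eq0. Qed.

Lemma corootE a : coroot dot a = (2 / dual_dot dot a a) *: riesz dot a.
Proof. exact: rieszZ. Qed.

Lemma coroot_dual_dot a b :
  b (coroot dot a) = 2 / dual_dot dot a a * dual_dot dot b a.
Proof. by rewrite corootE linearZ /= rieszE /dual_dot dotC. Qed.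

Lemma coroot_self a : a <> 0 -> a (coroot dot a) = 2.
Proof.
by move=> /dual_dot_gt0 a0; rewrite coroot_dual_dot divfK ?gt_eqF.
Qed.

Lemma coroot_neq0 a : a <> 0 -> coroot dot a != 0.
Proof.
move=> /coroot_self a2; apply/eqP => a0; move: a2; rewrite a0 linear0.
by move/esym/eqP; rewrite pnatr_eq0.
Qed.

Lemma corootN a : coroot dot (- a) = - coroot dot a.
Proof.
rewrite !corootE -scaleN1r rieszZ /dual_dot rieszZ !scaleN1r scalerN.
by rewrite -!scaleN1r dotZl dotZr mulrA mulrNN !mul1r.
Qed.

Definition refl_fun a y : E := y - a y *: coroot dot a.

Lemma refl_fun_linear a : linear (refl_fun a).
Proof.
move=> k y z; rewrite /refl_fun linearP scalerDl opprD -!scalerA scalerBr.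
by rewrite addrACA.
Qed.

HB.instance Definition _ a := GRing.isLinear.Build R E E *:%R
  (refl_fun a) (refl_fun_linear a).

Lemma reflE a y : refl dot a y = y - a y *: coroot dot a.
Proof. exact: (lfunE (refl_fun a)). Qed.

Lemma reflN a : refl dot (- a) = refl dot a.
Proof.
by apply/lfunP => y; rewrite !reflE opp_lfunE corootN scaleNr scalerN opprK.
Qed.

Lemma reflK a : a <> 0 -> (refl dot a \o refl dot a)%VF = \1%VF.
Proof.
move=> a0; apply/lfunP => y; rewrite comp_lfunE id_lfunE !reflE form_subZ.
rewrite coroot_self // -addrA -opprD -scalerDl.
have -> : a y + (a y - a y * 2) = 0 by ring.
by rewrite scale0r subr0.
Qed.

(** Identifies the reflected form in the axioms of [root_system] with precomposition by a
    reflection, which is how W acts on forms from here on. *)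
Lemma comp_refl a b :
  (b \o refl dot a)%VF = b - b (coroot dot a) *: a.
Proof.
apply/lfunP => y; rewrite comp_lfunE reflE form_subZ.
by rewrite add_lfunE opp_lfunE scale_lfunE /= [_ *: _]mulrC.
Qed.

Definition isometric w := forall x y, dot (w x) (w y) = dot x y.

Lemma refl_isometry a : a <> 0 -> isometric (refl dot a).
Proof.
move=> /dual_dot_gt0; rewrite /isometric /dual_dot; set v := riesz dot a => v0 x y.
rewrite !reflE corootE -/v /dual_dot -/v !scalerA !rieszE -/v.
rewrite !(dotBl, dotBr, dotZl, dotZr) (dotC v y).
have d_neq0 : dot v v != 0 by rewrite gt_eqF.
by field.
Qed.

End Euclidean.

Section RootTheory.
Context (R : realType) (E : vectType R) (dot : {dot E for idfun}).
Implicit Types (a b : 'Hom(E, R^o)) (w u v : 'End(E)) (x y z : E).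

Lemma isometry_ker0 w : isometric dot w -> lker w == 0%VS.
Proof.
move=> wi; apply/lker0P => x y wxy; apply/eqP; rewrite -subr_eq0.
apply: contraT => /(dot_gt0 dot).
by rewrite -wi linearB /= wxy subrr -(scale0r 0) dotZr mul0r ltxx.
Qed.

Lemma isometry_comp w u : isometric dot w -> isometric dot u ->
  isometric dot (w \o u)%VF.
Proof. by move=> wi ui x y; rewrite !comp_lfunE wi ui. Qed.

Lemma riesz_comp w a : isometric dot w ->
  w (riesz dot (a \o w)%VF) = riesz dot a.
Proof.
move=> wi; have w0 := isometry_ker0 wi.
have -> : riesz dot (a \o w)%VF = w^-1%VF (riesz dot a).
  apply: riesz_unique => y; rewrite comp_lfunE (rieszE dot) -[RHS]wi.
  by rewrite (lker0_lfunVK w0).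
by rewrite (lker0_lfunVK w0).
Qed.

Lemma coroot_comp w a : isometric dot w ->
  w (coroot dot (a \o w)%VF) = coroot dot a.
Proof.
move=> wi; rewrite !corootE linearZ /= riesz_comp //; congr (_ / _ *: _).
by rewrite /dual_dot -wi riesz_comp.
Qed.

(** The usual conjugation rule for reflections: an isometry w carries the coroot of a \o w to that
    of a. *)
Lemma refl_comp w a : isometric dot w ->
  (refl dot a \o w)%VF = (w \o refl dot (a \o w))%VF.
Proof.
move=> wi; apply/lfunP => y; rewrite !comp_lfunE !reflE endo_subZ.
by rewrite coroot_comp // comp_lfunE.
Qed.

Lemma comps_cat (s1 s2 : seq 'End(E)) :
  comps (s1 ++ s2) = (comps s1 \o comps s2)%VF.
Proof.
by elim: s1 => [|w s IH] /=; rewrite ?comp_lfun1l // IH comp_lfunA.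
Qed.

Section Weyl.
Context (Phi : set 'Hom(E, R^o)) (Phi_root : root_system dot Phi).

Local Notation W := (weyl dot Phi).

Lemma root_neq0 a : Phi a -> a <> 0.
Proof. by case: Phi_root => _ n0 _ _ Pa a0; apply: n0; rewrite -a0. Qed.

Lemma root_refl a b : Phi a -> Phi b -> Phi (b \o refl dot a)%VF.
Proof. by case: Phi_root => _ _ st _ Pa Pb; rewrite comp_refl; apply: st. Qed.

Lemma root_opp a : Phi a -> Phi (- a).
Proof.
move=> Pa; have := root_refl Pa Pa; rewrite comp_refl coroot_self; last first.
  exact: root_neq0.
by rewrite scaler_nat mulr2n opprD addrA subrr sub0r.
Qed.

Lemma weyl_ind (P : 'End(E) -> Prop) : P \1%VF ->
  (forall a w, Phi a -> W w -> P w -> P (refl dot a \o w)%VF) ->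
  forall w, W w -> P w.
Proof.
move=> P1 PS _ [s Ps ->]; elim: s Ps => //= a s IH Ps.
have Ps' : {in s, forall b, Phi b} by move=> b bs; apply: Ps; rewrite inE bs orbT.
apply: PS; last exact: IH; first by apply: Ps; rewrite inE eqxx.
by exists s.
Qed.

Lemma weyl1 : W \1%VF. Proof. by exists [::]. Qed.

Lemma weyl_refl a : Phi a -> W (refl dot a).
Proof.
move=> Pa; exists [:: a]; last by rewrite /= comp_lfun1r.
by move=> b; rewrite inE => /eqP ->.
Qed.

Lemma weyl_comp w u : W w -> W u -> W (w \o u)%VF.
Proof.
move=> [s Ps ->] [s' Ps' ->]; exists (s ++ s'); last by rewrite map_cat comps_cat.
by move=> b; rewrite mem_cat => /orP[/Ps|/Ps'].
Qed.

Lemma weyl_isometry w : W w -> isometric dot w.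
Proof.
move: w; apply: weyl_ind => [x y|a w Pa _ wi]; first by rewrite !id_lfunE.
by apply: isometry_comp => //; apply/refl_isometry/root_neq0.
Qed.

Lemma weyl_ker0 w : W w -> lker w == 0%VS.
Proof. by move=> /weyl_isometry /isometry_ker0. Qed.

Lemma weylK w : W w -> cancel w w^-1%VF.
Proof. by move=> /weyl_ker0 w0; apply: lker0_lfunK. Qed.

Lemma weylVK w : W w -> cancel w^-1%VF w.
Proof. by move=> /weyl_ker0 w0; apply: lker0_lfunVK. Qed.

Lemma weyl_compVw w : W w -> (w^-1 \o w)%VF = \1%VF.
Proof. by move=> /weyl_ker0 /lker0_compVf. Qed.

Lemma weyl_compwV w : W w -> (w \o w^-1)%VF = \1%VF.
Proof. by move=> /weyl_ker0 /lker0_compfV. Qed.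

Lemma weyl_inv w : W w -> W w^-1%VF.
Proof.
(* It suffices to find a right inverse inside W; it is the product of the same reflections in
   reverse order. *)
move=> Ww; suff [u Wu wu] : exists2 u, W u & (w \o u)%VF = \1%VF.
  suff -> : w^-1%VF = u by [].
  by rewrite -[LHS]comp_lfun1r -wu comp_lfunA weyl_compVw // comp_lfun1l.
move: w Ww; apply: weyl_ind => [|a w Pa Ww [u Wu wu]].
  by exists \1%VF; rewrite ?comp_lfun1l //; apply: weyl1.
exists (u \o refl dot a)%VF; first by apply: weyl_comp => //; apply: weyl_refl.
by rewrite comp_lfunA -(comp_lfunA _ w) wu comp_lfun1r reflK //; apply: root_neq0.
Qed.

Lemma weyl_invK w : W w -> (w^-1^-1)%VF = w.
Proof.
move=> Ww; have Wv := weyl_inv Ww.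
by rewrite -[LHS]comp_lfun1r -(weyl_compVw Ww) comp_lfunA weyl_compVw ?comp_lfun1l.
Qed.

Lemma weyl_inv_comp w u : W w -> W u -> ((w \o u)^-1)%VF = (u^-1 \o w^-1)%VF.
Proof.
move=> Ww Wu; have Wwu := weyl_comp Ww Wu.
rewrite -[RHS]comp_lfun1r -(weyl_compwV Wwu) !comp_lfunA -(comp_lfunA u^-1%VF).
by rewrite weyl_compVw // comp_lfun1r weyl_compVw // comp_lfun1l.
Qed.

Lemma weyl_injl w u v : W w -> (w \o u)%VF = (w \o v)%VF -> u = v.
Proof.
move=> Ww wuv; rewrite -[u]comp_lfun1l -[v]comp_lfun1l -(weyl_compVw Ww).
by rewrite -!comp_lfunA wuv.
Qed.

Lemma weyl_injr w u v : W w -> (u \o w)%VF = (v \o w)%VF -> u = v.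
Proof.
move=> Ww wuv; rewrite -[u]comp_lfun1r -[v]comp_lfun1r -(weyl_compwV Ww).
by rewrite !comp_lfunA wuv.
Qed.

Lemma root_weyl w a : W w -> Phi a -> Phi (a \o w)%VF.
Proof.
move=> Ww; move: w Ww a; apply: weyl_ind => [a|b w Pb _ IH a Pa].
  by rewrite comp_lfun1r.
by rewrite comp_lfunA; apply: IH; apply: root_refl.
Qed.

(* An element of [W] moves every vector within the span of the coroots. *)
Lemma weyl_move w y z : W w -> (forall a, Phi a -> dot z (coroot dot a) = 0) ->
  dot z (w y - y) = 0.
Proof.
move=> + z0; move: w; apply: weyl_ind => [|a w Pa _ IH].
  by rewrite id_lfunE subrr -(scale0r 0) dotZr mul0r.
rewrite comp_lfunE reflE addrAC dotBr IH dotZr z0 // mulr0.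
by rewrite subr0.
Qed.

Lemma dot_coroot_eq0 a z : Phi a -> a z = 0 -> dot z (coroot dot a) = 0.
Proof. by move=> Pa az; rewrite corootE dotZr -rieszE az mulr0. Qed.

(** The roots need not span the dual of E, so their values do not separate arbitrary points. They
    separate w y and u y: a difference killed by all roots is orthogonal to all coroots, hence by
    [weyl_move] to w y - y and u y - y, hence to itself. *)
Lemma weyl_eq w u y : W w -> W u ->
  (forall a, Phi a -> a (w y) = a (u y)) -> w y = u y.
Proof.
move=> Ww Wu wuy; apply/eqP; rewrite -subr_eq0; apply: contraT.
move=> /(dot_gt0 dot); have wu0 a : Phi a -> dot (w y - u y) (coroot dot a) = 0.
  by move=> Pa; apply: dot_coroot_eq0; rewrite // linearB /= wuy ?subrr.
have -> : w y - u y = (w y - y) - (u y - y) by rewrite opprB addrA subrK.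
have wu0' a : Phi a -> dot ((w y - y) - (u y - y)) (coroot dot a) = 0.
  by move=> /wu0; rewrite opprB addrA subrK.
by rewrite dotBr !weyl_move // subrr ltxx.
Qed.

Lemma weyl_faithful w u : W w -> W u ->
  (forall a, Phi a -> (a \o w)%VF = (a \o u)%VF) -> w = u.
Proof.
move=> Ww Wu wu; apply/lfunP => y; apply: weyl_eq => // a Pa.
by rewrite -!comp_lfunE wu.
Qed.

(** An element of W is determined by the self-map of the finite set Phi that it induces; [h]
    recovers the element from this map. *)
Lemma weyl_finite : finite_set W.
Proof.
have [Phi_fin _ _ _] := Phi_root.
pose P := fset_set Phi.
have inP a : (a \in P) <-> Phi a by rewrite in_fset_set // inE.
have mP w (Ww : W w) (a : P) : (val a \o w)%VF \in P.
  by apply/inP/root_weyl => //; apply/inP; apply: valP.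
pose h (phi : {ffun P -> P}) := xget \1%VF
  [set w | W w /\ forall a : P, (val a \o w)%VF = val (phi a)].
apply: (@sub_finite_set _ _ (h @` setT)); last first.
  exact/finite_image/finite_finset.
move=> w Ww; exists [ffun a => [` mP w Ww a]%fset] => //.
apply: xget_unique => [|u [Wu uE]]; first by split=> // a; rewrite ffunE.
apply: weyl_faithful => // a /inP Pa.
by rewrite (uE [` Pa]%fset) ffunE.
Qed.

End Weyl.
End RootTheory.

(** * Simple roots and length *)

Definition based_root_system (R : realType) (E : vectType R)
    (dot : {dot E for idfun}) (Phi : set 'Hom(E, R^o))
    (r : nat) (alpha : 'I_r -> 'Hom(E, R^o)) : Prop :=
  [/\ root_system dot Phi, reduced_rs Phi & simple_roots Phi alpha].

Section SimpleRoots.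
Context (R : realType) (E : vectType R) (dot : {dot E for idfun}).
Context (Phi : set 'Hom(E, R^o)) (r : nat) (alpha : 'I_r -> 'Hom(E, R^o)).
Context (based : based_root_system dot Phi alpha).

Let Phi_root : root_system dot Phi. Proof. by case: based. Qed.
Let Phi_reduced : reduced_rs Phi. Proof. by case: based. Qed.
Let alpha_simple : simple_roots Phi alpha. Proof. by case: based. Qed.

Implicit Types (a b : 'Hom(E, R^o)) (w u v : 'End(E)) (x y z : E).
Implicit Types (i j k : 'I_r) (s : seq 'I_r).

Local Notation W := (weyl dot Phi).
Local Notation pos := (pos_roots Phi alpha).
Local Notation len := (len dot alpha).
Local Notation word := (word dot alpha).
Local Notation sigma j := (refl dot (alpha j)).

Lemma alpha_root j : Phi (alpha j). Proof. by case: alpha_simple. Qed.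

(** The coordinate functions of a free family are dual to it. [om0 k] is the vector representing the
    k-th coordinate, read on E through [dot_form]. *)
Lemma fundamental_coweights : exists omega : 'I_r -> E,
  forall i j, alpha i (omega j) = (i == j)%:R.
Proof.
have [_ free_alpha _] := alpha_simple.
pose X := [tuple of [seq alpha i | i <- enum 'I_r]].
have freeX : free X by [].
pose om0 (k : 'I_#|'I_r|) :=
  riesz dot (linfun (coord X k \o dot_form dot : E -> R^o) : 'Hom(E, R^o)).
have om0E (k i : 'I_#|'I_r|) : alpha (enum_val i) (om0 k) = (i == k)%:R.
  rewrite (rieszE dot) dotC -rieszE lfunE /=.
  have -> : dot_form dot (riesz dot (alpha (enum_val i))) = X`_i.
    apply/lfunP => y; rewrite dot_formE -rieszE (nth_map (enum_val i)) //.
      by rewrite -enum_val_nth.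
    by rewrite -cardE.
  by rewrite coord_free.
exists (fun j => om0 (enum_rank j)) => i j.
by rewrite -[in alpha i](enum_rankK i) om0E (inj_eq enum_rank_inj).
Qed.

Definition omega : 'I_r -> E := xget (fun=> 0)
  [set om | forall i j, alpha i (om j) = (i == j)%:R].

Lemma omegaE i j : alpha i (omega j) = (i == j)%:R.
Proof.
exact: (@xgetPex _ (fun=> 0)
  [set om | forall i j, alpha i (om j) = (i == j)%:R] fundamental_coweights).
Qed.

(** The regular dominant vector at which signs are tested: a root is positive when its value here
    is, this value being the height. Below, alpha_j (w rho) < 0 says that s_j w is shorter than w,
    and alpha_j (w^-1 rho) < 0 that w s_j is. *)
Definition rho : E := \sum_j omega j.

Lemma comb_omega (k : 'I_r -> nat) j : (\sum_i alpha i *+ k i) (omega j) = (k j)%:R.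
Proof.
rewrite sum_lfunE (bigD1 j) //= big1 => [|i ij].
  by rewrite addr0 -scaler_nat scale_lfunE omegaE eqxx /= [_ *: _]mulr1.
by rewrite -scaler_nat scale_lfunE omegaE (negPf ij) scaler0.
Qed.

Lemma comb_rho (k : 'I_r -> nat) : (\sum_i alpha i *+ k i) rho = (\sum_i k i)%:R.
Proof.
rewrite linear_sum natr_sum; apply: eq_bigr => j _; exact: comb_omega.
Qed.

Lemma alpha_rho j : alpha j rho = 1.
Proof.
rewrite linear_sum (bigD1 j) //= big1 => [|i ij]; last first.
  by rewrite omegaE eq_sym (negPf ij).
by rewrite addr0 omegaE eqxx.
Qed.

Lemma pos_root a : pos a -> Phi a. Proof. by case. Qed.

Lemma pos_omega_ge0 a j : pos a -> 0 <= a (omega j).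
Proof. by case=> _ [k ->]; rewrite comb_omega ler0n. Qed.

Lemma pos_rho_ge1 a : pos a -> 1 <= a rho.
Proof.
case=> Pa [k ak]; rewrite ak comb_rho ler1n lt0n; apply/eqP => k0.
apply: (root_neq0 Phi_root Pa); rewrite ak big1 // => i _.
have : k i == 0%N by rewrite -leqn0 -k0 (bigD1 i) //= leq_addr.
by move=> /eqP ->; rewrite mulr0n.
Qed.

Lemma pos_rho a : Phi a -> pos a <-> 0 < a rho.
Proof.
move=> Pa; split=> [/pos_rho_ge1|a0]; first exact: lt_le_trans.
have [_ _ /(_ _ Pa)[//|/pos_rho_ge1]] := alpha_simple.
rewrite opp_lfunE => le1; have := lt_le_trans ltr01 le1.
by rewrite oppr_gt0 => /(lt_trans a0); rewrite ltxx.
Qed.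

Lemma root_rho_neq0 a : Phi a -> a rho != 0.
Proof.
move=> Pa; have [_ _ /(_ _ Pa)[/pos_rho_ge1|/pos_rho_ge1]] := alpha_simple.
  by move=> /(lt_le_trans ltr01) /gt_eqF ->.
rewrite opp_lfunE => /(lt_le_trans ltr01); rewrite oppr_gt0 => /lt_eqF ->.
by [].
Qed.

Lemma neg_rho a : Phi a -> a rho < 0 -> pos (- a).
Proof.
move=> Pa a0; apply/pos_rho; first exact: (root_opp Phi_root).
by rewrite opp_lfunE oppr_gt0.
Qed.

Lemma pos_alpha j : pos (alpha j).
Proof. by apply/pos_rho; rewrite ?alpha_rho ?ltr01 //; apply: alpha_root. Qed.

Lemma W_sigma j : W (sigma j).
Proof. by apply: weyl_refl; apply: alpha_root. Qed.

Lemma sigmaK j : (sigma j \o sigma j)%VF = \1%VF.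
Proof. by apply: reflK; apply: (root_neq0 Phi_root); apply: alpha_root. Qed.

Lemma sigmaKl j w : (sigma j \o (sigma j \o w))%VF = w.
Proof. by rewrite comp_lfunA sigmaK comp_lfun1l. Qed.

Lemma sigmaKr j w : ((w \o sigma j) \o sigma j)%VF = w.
Proof. by rewrite -comp_lfunA sigmaK comp_lfun1r. Qed.

Lemma alpha_sigma j : (alpha j \o sigma j)%VF = - alpha j.
Proof.
rewrite comp_refl coroot_self; last exact/(root_neq0 Phi_root)/alpha_root.
by rewrite scaler_nat mulr2n opprD addrA subrr sub0r.
Qed.

(* [s_j] changes only the [j]-th coefficient of [b]. *)
Lemma pos_sigma b j : pos b -> b <> alpha j -> pos (b \o sigma j)%VF.
Proof.
move=> pb bj; have Pb := pos_root pb; have Pj := alpha_root j.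
have Pbj : Phi (b \o sigma j)%VF by apply: (root_refl Phi_root).
have [_ _ /(_ _ Pbj)[//|nbj]] := alpha_simple.
have b0 i : i != j -> b (omega i) = 0.
  move=> ij; apply/le_anti; rewrite pos_omega_ge0 // andbT.
  have := pos_omega_ge0 i nbj; rewrite opp_lfunE comp_lfunE reflE omegaE eq_sym.
  by rewrite (negPf ij) scale0r subr0 oppr_ge0.
case: pb => _ [k bk].
have {}bk : b = (k j)%:R *: alpha j.
  rewrite bk (bigD1 j) //= big1 ?addr0 ?scaler_nat // => i ij.
  have /eqP := b0 i ij; rewrite bk comb_omega pnatr_eq0 => /eqP ->.
  by rewrite mulr0n.
have [k1|k1] : (k j)%:R = 1 :> R \/ (k j)%:R = -1 :> R.
- by apply: (Phi_reduced Pj); rewrite -bk.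
- by case: bj; rewrite bk k1 scale1r.
- have := ler0n R (k j); rewrite k1 oppr_ge0 => /(lt_le_trans ltr01).
  by rewrite ltxx.
Qed.

Lemma word_cat s1 s2 : word (s1 ++ s2) = (word s1 \o word s2)%VF.
Proof. by rewrite /Defs.word map_cat comps_cat. Qed.

Lemma word_cons j s : word (j :: s) = (sigma j \o word s)%VF.
Proof. by []. Qed.

Lemma word1 j : word [:: j] = sigma j.
Proof. by rewrite word_cons comp_lfun1r. Qed.

Lemma W_word s : W (word s).
Proof.
elim: s => [|j s IH]; first exact: weyl1.
by rewrite word_cons; apply: weyl_comp => //; apply: W_sigma.
Qed.

(** Since b is a nonnegative combination of simple roots and its square norm is positive, its
    product with some simple root is positive. *)
Lemma exists_descent b : pos b -> exists j, 0 < b (coroot dot (alpha j)).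
Proof.
move=> pb; apply: contrapT => nex.
have : 0 < dual_dot dot b b by apply/dual_dot_gt0/(root_neq0 Phi_root)/pos_root.
case: pb => _ [k bk]; rewrite {2}bk /dual_dot -rieszE sum_lfunE.
apply/negP; rewrite -leNgt; apply: sumr_le0 => i _.
rewrite -scaler_nat scale_lfunE; apply: mulr_ge0_le0; first exact: ler0n.
have ai : 0 < dual_dot dot (alpha i) (alpha i).
  by apply/dual_dot_gt0/(root_neq0 Phi_root)/alpha_root.
move/forallNP: nex => /(_ i) /negP; rewrite -leNgt coroot_dual_dot.
rewrite pmulr_rle0 ?divr_gt0 ?ltr0n // /dual_dot.
by rewrite -rieszE.
Qed.

(** Induction on the height b rho: conjugation by a simple reflection with b (coroot alpha_j) > 0
    gives a positive root of smaller height, until b itself is simple. *)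
Lemma pos_refl_word b : pos b -> exists s, refl dot b = word s.
Proof.
have hgt a : pos a -> exists n : nat, a rho = n%:R.
  by case=> _ [k ->]; exists (\sum_i k i)%N; rewrite comb_rho.
move=> pb; have [n] := hgt b pb; elim/ltn_ind: n b pb => n IH b pb bn.
have [j bj] := exists_descent pb.
have [->|nbj] := pselect (b = alpha j); first by exists [:: j]; rewrite word1.
have pb' := pos_sigma pb nbj; have [n' bn'] := hgt _ pb'.
have ltn' : (n' < n)%N.
  rewrite -(ltr_nat R) -bn -bn' comp_refl add_lfunE opp_lfunE scale_lfunE.
  by rewrite alpha_rho [_ *: _]mulr1 ltrBlDr ltrDl.
have [s bs] := IH n' ltn' _ pb' bn'.
exists (j :: rcons s j); rewrite word_cons -cats1 word_cat word1 -bs comp_lfunA.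
have := refl_comp b (weyl_isometry Phi_root (W_sigma j)) => <-.
by rewrite sigmaKr.
Qed.

Lemma weyl_wordP w : W w <-> exists s, word s = w.
Proof.
split=> [|[s <-]]; last exact: W_word.
move: w; apply: (weyl_ind (dot := dot)) => [|a w Pa _ [s <-]].
  by exists [::].
suff [s' ->] : exists s', refl dot a = word s' by exists (s' ++ s); rewrite word_cat.
have [_ _ /(_ _ Pa)[|]] := alpha_simple; first exact: pos_refl_word.
by move=> /pos_refl_word; rewrite reflN.
Qed.

Lemma rexP w : W w -> reduced_expr dot alpha w (rex dot alpha w).
Proof.
move=> /weyl_wordP[s0 ws0].
apply: (@xgetPex _ [::] [set s | reduced_expr dot alpha w s]).
have [n] := ubnP (size s0); elim: n s0 ws0 => // n IH s0 ws0 szs0.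
have [ns0|/forallNP s0min] :=
    pselect (exists s', word s' = w /\ (size s' < size s0)%N).
  have [s' [ws' lts']] := ns0.
  by apply: (IH s' ws'); apply: leq_trans lts' _.
exists s0; split=> // s' ws'; rewrite leqNgt; apply/negP => lts.
by apply: (s0min s').
Qed.

Lemma word_rex w : W w -> word (rex dot alpha w) = w.
Proof. by case/rexP. Qed.

Lemma len_word s : (len (word s) <= size s)%N.
Proof. by have [_] := rexP (W_word s); apply. Qed.

(** The root b is carried through the word letter by letter. Just before it turns negative it equals
    the simple root of the next letter, by [pos_sigma], and the reflection in b then cancels exactly
    this letter. *)
Lemma exchange b s : pos b -> (b \o word s)%VF rho < 0 ->
  exists s1 i s2, s = s1 ++ i :: s2 /\
    (refl dot b \o word s)%VF = word (s1 ++ s2).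
Proof.
elim: s b => [|i s IH] b pb.
  rewrite comp_lfun1r => b0; have := pos_rho_ge1 pb.
  by move=> /(lt_le_trans ltr01)/(lt_trans b0); rewrite ltxx.
have [bi|nbi] := pselect (b = alpha i).
  by move=> _; exists [::], i, s; split=> //; rewrite bi word_cons sigmaKl.
rewrite word_cons comp_lfunA => /(IH _ (pos_sigma pb nbi))[s1 [k [s2 [-> bE]]]].
exists (i :: s1), k, s2; split=> //.
rewrite cat_cons word_cons -bE !comp_lfunA; congr (_ \o _)%VF.
exact/refl_comp/(weyl_isometry Phi_root)/W_sigma.
Qed.

Lemma root_alpha_weyl w j : W w -> Phi (alpha j \o w)%VF.
Proof. by move=> Ww; apply: (root_weyl Phi_root Ww); apply: alpha_root. Qed.

Lemma W_sigmal j w : W w -> W (sigma j \o w)%VF.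
Proof. by move=> Ww; apply: weyl_comp => //; apply: W_sigma. Qed.

Lemma W_sigmar j w : W w -> W (w \o sigma j)%VF.
Proof. by move=> Ww; apply: weyl_comp => //; apply: W_sigma. Qed.

Lemma alpha_sigma_rho j w :
  alpha j ((sigma j \o w)%VF rho) = - alpha j (w rho).
Proof. by rewrite -comp_lfunE comp_lfunA alpha_sigma !comp_lfunE opp_lfunE. Qed.

Lemma len_desc_lt j w : W w -> alpha j (w rho) < 0 ->
  (len (sigma j \o w)%VF < len w)%N.
Proof.
move=> Ww wj; have ws := word_rex Ww.
have := @exchange (alpha j) (rex dot alpha w) (pos_alpha j).
rewrite ws comp_lfunE => /(_ wj)[s1 [i [s2 [sE ->]]]].
apply: leq_ltn_trans (len_word _) _.
by rewrite /Defs.len sE !size_cat /= addnS.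
Qed.

Lemma len_sigma_le j w : W w -> (len (sigma j \o w)%VF <= (len w).+1)%N.
Proof.
by move=> Ww; rewrite -{1}(word_rex Ww) -word_cons; apply: len_word.
Qed.

Lemma len_desc j w : W w -> alpha j (w rho) < 0 ->
  len w = (len (sigma j \o w)%VF).+1.
Proof.
move=> Ww wj; apply/eqP; rewrite eqn_leq len_desc_lt // andbT.
by rewrite -{1}(sigmaKl j w); apply: len_sigma_le; apply: W_sigmal.
Qed.

Lemma len_asc j w : W w -> 0 < alpha j (w rho) ->
  len (sigma j \o w)%VF = (len w).+1.
Proof.
move=> Ww wj; rewrite (@len_desc j) ?sigmaKl //; first exact: W_sigmal.
by rewrite alpha_sigma_rho oppr_lt0.
Qed.

Lemma alpha_rho_cases j w : W w -> 0 < alpha j (w rho) \/ alpha j (w rho) < 0.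
Proof.
move=> Ww; have := root_rho_neq0 (root_alpha_weyl j Ww); rewrite comp_lfunE.
by rewrite neq_lt => /orP[]; [right|left].
Qed.

Lemma len0 : len \1%VF = 0%N.
Proof. by apply/eqP; rewrite -leqn0; exact: (len_word [::]). Qed.

Lemma len_eq0 w : W w -> len w = 0%N -> w = \1%VF.
Proof. by move=> Ww /size0nil w0; rewrite -(word_rex Ww) w0. Qed.

Definition is_reduced s := len (word s) = size s.

Lemma is_reduced_rex w : W w -> is_reduced (rex dot alpha w).
Proof. by move=> Ww; rewrite /is_reduced word_rex. Qed.

Lemma len_comp_le w u : W w -> W u -> (len (w \o u)%VF <= len w + len u)%N.
Proof.
move=> Ww Wu; rewrite -{1}(word_rex Ww) -{1}(word_rex Wu) -word_cat.
by apply: leq_trans (len_word _) _; rewrite size_cat.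
Qed.

Lemma is_reduced_cat s1 s2 : is_reduced (s1 ++ s2) ->
  is_reduced s1 /\ is_reduced s2.
Proof.
rewrite /is_reduced word_cat size_cat => ls.
have := len_comp_le (W_word s1) (W_word s2); rewrite ls.
have := len_word s1; have := len_word s2.
by move=> l2 l1 l12; split; apply/eqP; rewrite eqn_leq ?l1 ?l2 /=; lia.
Qed.

Lemma word_rev s : word (rev s) = ((word s)^-1)%VF.
Proof.
have rK : (word s \o word (rev s))%VF = \1%VF.
  elim: s => [|j s IH]; first by rewrite comp_lfun1l.
  rewrite word_cons rev_cons -cats1 word_cat word1 !comp_lfunA.
  by rewrite -(comp_lfunA (sigma j)) IH comp_lfun1r sigmaK.
apply: (weyl_injl Phi_root (W_word s)).
by rewrite rK (weyl_compwV Phi_root) //; apply: W_word.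
Qed.

Lemma len_inv w : W w -> len (w^-1)%VF = len w.
Proof.
have le v : W v -> (len (v^-1)%VF <= len v)%N.
  move=> Wv; rewrite -{1}(word_rex Wv) -word_rev.
  by apply: leq_trans (len_word _) _; rewrite size_rev.
move=> Ww; apply/eqP; rewrite eqn_leq le //=.
by rewrite -{1}(weyl_invK Phi_root Ww) le //; apply: (weyl_inv Phi_root).
Qed.

Lemma is_reduced_cons j s : is_reduced (j :: s) -> alpha j (word (j :: s) rho) < 0.
Proof.
move=> rs; have [|//] := alpha_rho_cases j (W_word (j :: s)).
move=> /(len_asc (W_word _)); rewrite word_cons sigmaKl -word_cons rs => ls.
by have := len_word s; rewrite ls /=; lia.
Qed.

Lemma no_descent w : W w -> (forall j, 0 < alpha j (w rho)) -> w = \1%VF.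
Proof.
move=> Ww wpos; have := is_reduced_rex Ww; have := word_rex Ww.
case: (rex dot alpha w) => [<- //|j s] ws /is_reduced_cons.
by rewrite ws => /(lt_trans (wpos j)); rewrite ltxx.
Qed.

End SimpleRoots.

(** * Matsumoto's theorem *)

Section Matsumoto.
Context (R : realType) (E : vectType R) (dot : {dot E for idfun}).
Context (Phi : set 'Hom(E, R^o)) (r : nat) (alpha : 'I_r -> 'Hom(E, R^o)).
Context (based : based_root_system dot Phi alpha).
Implicit Types (a b i j k : 'I_r) (w u v : 'End(E)) (x y z : E) (s : seq 'I_r).

Local Notation W := (weyl dot Phi).
Local Notation len := (len dot alpha).
Local Notation word := (word dot alpha).
Local Notation sigma j := (refl dot (alpha j)).
Local Notation rho := (rho alpha).
Local Notation is_reduced := (is_reduced dot alpha).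
Let Phi_root : root_system dot Phi. Proof. by case: based. Qed.
Let W_word s : W (word s). Proof. exact: W_word. Qed.

Lemma braid_wordS a b m : braid_word a b m.+1 = a :: braid_word b a m.
Proof.
rewrite /braid_word /mkseq /= -[1%N]addn0 iotaDl -map_comp; congr (_ :: _).
by apply: eq_map => k /=; case: (odd k).
Qed.

Lemma size_braid_word a b m : size (braid_word a b m) = m.
Proof. by rewrite size_mkseq. Qed.

(** If the two alternating words of length p agreed, putting the letter a in front of the one
    starting with b would give an alternating word of length p + 1, part of a reduced word, that
    equals one of length p - 1. *)
Lemma is_reduced_neq_braid a b m : is_reduced (braid_word a b m) ->
  forall p, (0 < p < m)%N -> word (braid_word a b p) <> word (braid_word b a p).
Proof.
elim: m a b => [|m IH] a b; first by move=> _ k; rewrite ltn0 andbF.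
move=> rm [//|p] /andP[_ pm] eqp.
have tp : take p.+2 (braid_word a b m.+1) = braid_word a b p.+2.
  rewrite /braid_word /mkseq -map_take take_iota; congr map.
  by congr iota; lia.
have [rk _] : is_reduced (braid_word a b p.+2) /\
    is_reduced (drop p.+2 (braid_word a b m.+1)).
  by apply: (is_reduced_cat based); rewrite -tp cat_take_drop.
have := len_word based (braid_word b a p); rewrite leqNgt => /negP; apply.
have -> : word (braid_word b a p) = word (braid_word a b p.+2).
  rewrite braid_wordS [RHS]word_cons -eqp [in RHS]braid_wordS word_cons.
  by rewrite (sigmaKl based).
by rewrite rk !size_braid_word.
Qed.

(** With c = s_a s_b, the k-th power of c carries the alternating word of length k starting with b
    to the one starting with a. So c^k = 1 exactly when the two words agree, and the first such k >
    0 is m because the words are reduced. This supplies the order required by the braid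
    relations. *)
Lemma braid_end_order a b m : (0 < m)%N ->
  is_reduced (braid_word a b m) -> is_reduced (braid_word b a m) ->
  word (braid_word a b m) = word (braid_word b a m) ->
  end_order (srefl dot alpha a \o srefl dot alpha b)%VF m.
Proof.
move=> m0 rab rba eqab; rewrite /srefl; set c := (_ \o _)%VF.
have powS (k : nat) (u : 'End(E)) :
    (comps (nseq k.+1 c) \o u = c \o (comps (nseq k c) \o u))%VF.
  by rewrite /= comp_lfunA.
have powSr (k : nat) (u : 'End(E)) :
    (comps (nseq k.+1 c) \o u = comps (nseq k c) \o (c \o u))%VF.
  by rewrite -addn1 nseqD comps_cat -comp_lfunA /= comp_lfun1r.
have shift (k : nat) : (c \o word (braid_word b a k.+2))%VF = word (braid_word b a k).
  by rewrite !braid_wordS !word_cons /c -comp_lfunA !(sigmaKl based).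
have cpow (k : nat) : (comps (nseq k c) \o word (braid_word b a k))%VF =
              word (braid_word a b k).
  elim/ltn_ind: k => [] [|[|k]] IH.
  - by rewrite /= comp_lfun1l.
  - rewrite /= comp_lfun1r /c -comp_lfunA !braid_wordS !word_cons.
    by rewrite (sigmaKl based).
  rewrite powSr shift powS IH //.
  by rewrite /c -comp_lfunA !braid_wordS !word_cons.
split=> // [|k k0 ck].
  apply: (weyl_injr Phi_root (W_word (braid_word b a m))).
  by rewrite cpow comp_lfun1l.
rewrite leqNgt; apply/negP => km.
apply: (@is_reduced_neq_braid a b m rab k); first by rewrite k0.
by rewrite -cpow ck comp_lfun1l.
Qed.

Section Product.
Context (A : pzRingType) (T : 'I_r -> A).
Context (braid : forall a b m,
  end_order (srefl dot alpha a \o srefl dot alpha b)%VF m ->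
  \prod_(k <- braid_word a b m) T k = \prod_(k <- braid_word b a m) T k).

Local Notation prodT s := (\prod_(k <- s) T k).

(** The induction hypothesis of Matsumoto's theorem in length n; reducedness gives the second word
    the same length. *)
Definition product_unique n := forall s s', size s = n ->
  is_reduced s -> is_reduced s' -> word s = word s' -> prodT s = prodT s'.

(** Exchange puts b in front of s at the cost of one letter of s. The new word shares its first
    letter with b :: s'. If the deleted letter is not the last of s, the new word also shares its
    last letter with s, and two uses of the hypothesis in length n conclude; otherwise the second
    alternative holds. *)
Lemma exchange_product n b s s' : product_unique n -> size s = n.+1 ->
  is_reduced s -> is_reduced (b :: s') -> word s = word (b :: s') ->
  prodT s = prodT (b :: s') \/
  exists s1 i, [/\ s = rcons s1 i, is_reduced (b :: s1), word (b :: s1) = word s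
    & prodT (b :: s1) = prodT (b :: s')].
Proof.
move=> uniq_n szs rs rs' eqs; have [_ rt] := is_reduced_cat based (s1 := [:: b]) rs'.
have : (alpha b \o word s)%VF rho < 0.
  by rewrite eqs comp_lfunE; apply: (is_reduced_cons based).
move=> /(exchange based (pos_alpha based b))[s1 [i [s2 [sE zE]]]].
have szs12 : size (s1 ++ s2) = n.
  by move: szs; rewrite sE !size_cat /= addnS => -[].
have wz : word (b :: s1 ++ s2) = word s.
  by rewrite word_cons -zE (sigmaKl based).
have rz : is_reduced (b :: s1 ++ s2) by rewrite /is_reduced wz rs szs /= szs12.
have [_ rz'] := is_reduced_cat based (s1 := [:: b]) rz.
have eqz : prodT (b :: s1 ++ s2) = prodT (b :: s').
  rewrite !big_cons; congr (_ * _); apply: uniq_n => //.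
  by apply: (weyl_injl Phi_root (W_sigma based b)); rewrite -!word_cons wz.
case/lastP: s2 sE {zE} szs12 wz rz {rz'} eqz => [|s2 e] sE szs12 wz rz eqz.
  by right; exists s1, i; rewrite cats0 in rz wz eqz; rewrite -cats1.
left; rewrite -eqz; have sE' : s = (s1 ++ i :: s2) ++ [:: e].
  by rewrite sE -cats1 -catA.
rewrite -cats1 catA -cat_cons in rz wz *.
rewrite {}sE' in rs szs wz *.
have [rs1 _] := is_reduced_cat based rs; have [rz1 _] := is_reduced_cat based rz.
have prod1 s0 : prodT (s0 ++ [:: e]) = prodT s0 * T e by rewrite big_cat big_seq1.
rewrite !prod1; congr (_ * _); apply: uniq_n => //.
  by move: szs; rewrite size_cat addn1 => -[].
apply: (weyl_injr Phi_root (W_word [:: e])).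
by rewrite -!(word_cat dot) -wz.
Qed.

(* Exchanging the head [b] of the second word into the first one either yields
   a word sharing its last letter with the first one, or lengthens the
   alternating prefix at the expense of [q].  Once [q] is exhausted, the two
   alternating words are related by a braid relation. *)
Lemma alternating_product n p q a b m s : product_unique n ->
  size q = p -> (0 < m)%N -> (m + p)%N = n.+1 ->
  is_reduced (braid_word a b m ++ q) -> is_reduced (b :: s) ->
  word (braid_word a b m ++ q) = word (b :: s) ->
  prodT (braid_word a b m ++ q) = prodT (b :: s).
Proof.
move=> uniq_n; elim: p q a b m s => [|p IHp] q a b m s szq m0 mp rq rs eqs.
all: have szy : size (braid_word a b m ++ q) = n.+1
  by rewrite size_cat size_braid_word szq.
all: have [//|[s1 [i [yE rz wz <-]]]] := exchange_product uniq_n szy rq rs eqs.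
  have q0 := size0nil szq; rewrite q0 cats0 in rq wz yE *.
  case: m m0 mp rq wz yE {szy eqs} => // m _ mp rq wz.
  rewrite {1}/braid_word mkseqS => /rcons_inj[s1E _].
  have zE : b :: s1 = braid_word b a m.+1 by rewrite braid_wordS -s1E.
  by rewrite zE in rz wz *; apply: braid; apply: braid_end_order.
case/lastP: q szq rq yE wz {szy eqs} => // q e; rewrite size_rcons => -[szq] rq.
rewrite -rcons_cat => /rcons_inj[s1E _] wz.
have zE : b :: s1 = braid_word b a m.+1 ++ q by rewrite braid_wordS -s1E.
case: m m0 mp rq zE {s1E} wz => // m _ mp rq zE wz.
rewrite zE in rz wz *; rewrite (braid_wordS a) ?rcons_cat cat_cons in rq wz *.
by apply: esym; apply: IHp => //; lia.
Qed.

Lemma reduced_product s s' : is_reduced s -> is_reduced s' ->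
  word s = word s' -> prodT s = prodT s'.
Proof.
move: {-2}(size s) (erefl (size s)) => n; elim: n s s' => [|n IHn] s s' szs rs rs' eqs.
  have : size s' = 0%N by rewrite -rs' -eqs rs.
  by move=> /size0nil ->; rewrite (size0nil (esym szs)).
case: s szs rs eqs => // a q [szq] rq eqs.
case: s' rs' eqs => [|b s] rs eqs.
  by move: rq; rewrite /is_reduced eqs (len0 based).
(* The first letter alone is an alternating prefix of length 1. *)
apply: (@alternating_product n n q a b 1 s) => //.
by move=> s1 s2 sz1; apply: IHn; rewrite sz1.
Qed.

End Product.
End Matsumoto.

(** * Stabilizers of dominant points *)

Section Parabolic.
Context (R : realType) (E : vectType R) (dot : {dot E for idfun}).
Context (Phi : set 'Hom(E, R^o)) (r : nat) (alpha : 'I_r -> 'Hom(E, R^o)).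
Context (based : based_root_system dot Phi alpha).
Implicit Types (a b : 'Hom(E, R^o)) (i j k : 'I_r) (w u v : 'End(E)).
Implicit Types (x y z : E) (s : seq 'I_r).

Local Notation W := (weyl dot Phi).
Local Notation pos := (pos_roots Phi alpha).
Local Notation len := (len dot alpha).
Local Notation word := (word dot alpha).
Local Notation rex := (rex dot alpha).
Local Notation sigma j := (refl dot (alpha j)).
Local Notation rho := (rho alpha).
Local Notation is_reduced := (is_reduced dot alpha).

Let Phi_root : root_system dot Phi. Proof. by case: based. Qed.

Lemma sigma_inv j : ((sigma j)^-1)%VF = sigma j.
Proof.
apply: (weyl_injl Phi_root (W_sigma based j)).
by rewrite (sigmaK based) (weyl_compwV Phi_root) //; apply: W_sigma.
Qed.

Lemma inv1 : (\1^-1)%VF = \1%VF :> 'End(E).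
Proof.
by rewrite -[LHS]comp_lfun1l (weyl_compwV Phi_root) //; apply: weyl1.
Qed.

Lemma inv_sigmar w j : W w -> ((w \o sigma j)^-1)%VF = (sigma j \o w^-1)%VF.
Proof.
by move=> Ww; rewrite (weyl_inv_comp Phi_root) ?sigma_inv //; apply: W_sigma.
Qed.

Lemma inv_sigmal w j : W w -> ((sigma j \o w)^-1)%VF = (w^-1 \o sigma j)%VF.
Proof.
by move=> Ww; rewrite (weyl_inv_comp Phi_root) ?sigma_inv //; apply: W_sigma.
Qed.

Lemma len_ascr j w : W w -> 0 < alpha j ((w^-1)%VF rho) ->
  len (w \o sigma j)%VF = (len w).+1.
Proof.
move=> Ww wj; rewrite -(len_inv based); last exact: W_sigmar.
rewrite inv_sigmar // (len_asc based) ?(len_inv based) //.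
exact: (weyl_inv Phi_root).
Qed.

Lemma len_descr j w : W w -> alpha j ((w^-1)%VF rho) < 0 ->
  len w = (len (w \o sigma j)%VF).+1.
Proof.
move=> Ww wj; rewrite -(@len_ascr j) ?(sigmaKr based) //; first exact: W_sigmar.
by rewrite inv_sigmar // (alpha_sigma_rho based) oppr_gt0.
Qed.

Lemma sign_sigmal (A : pzRingType) j w : W w ->
  (-1) ^+ len (sigma j \o w)%VF = - (-1) ^+ len w :> A.
Proof.
move=> Ww; have [/(len_asc based Ww)|/(len_desc based Ww)] := alpha_rho_cases based j Ww.
  by move=> ->; rewrite exprS mulN1r.
by move=> ->; rewrite exprS mulN1r opprK.
Qed.

Lemma sign_sigmar (A : pzRingType) j w : W w ->
  (-1) ^+ len (w \o sigma j)%VF = - (-1) ^+ len w :> A.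
Proof.
move=> Ww; rewrite -(len_inv based) ?inv_sigmar //; last exact: W_sigmar.
rewrite sign_sigmal; last exact: (weyl_inv Phi_root).
by rewrite (len_inv based).
Qed.

Section ProductOverReducedWord.
Context (A : pzRingType) (T : 'I_r -> A).
Context (braid : forall i j m,
  end_order (srefl dot alpha i \o srefl dot alpha j)%VF m ->
  \prod_(k <- braid_word i j m) T k = \prod_(k <- braid_word j i m) T k).

(** The common form of [Tw] and [tw], both convertible to it, so that each product formula is proved
    once for the Hecke algebra and for the parameters. *)
Definition rprod w := \prod_(k <- rex w) T k.

Lemma rprod_word s : is_reduced s -> rprod (word s) = \prod_(k <- s) T k.
Proof.
move=> rs; apply: (reduced_product based braid) => //.
  by apply: (is_reduced_rex based); apply: W_word based _.
by apply: (word_rex based); apply: W_word based _.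
Qed.

Lemma rprod1 : rprod \1%VF = 1.
Proof. by rewrite -[\1%VF]/(word [::]) rprod_word ?big_nil //; exact: (len0 based). Qed.

Lemma rprod_asc j w : W w -> 0 < alpha j (w rho) ->
  rprod (sigma j \o w)%VF = T j * rprod w.
Proof.
move=> Ww wj; rewrite -{1}(word_rex based Ww) -word_cons rprod_word ?big_cons //.
by rewrite /is_reduced word_cons (word_rex based Ww) (len_asc based).
Qed.

Lemma rprod_desc j w : W w -> alpha j (w rho) < 0 ->
  rprod w = T j * rprod (sigma j \o w)%VF.
Proof.
move=> Ww wj; rewrite -rprod_asc ?(sigmaKl based) //; first exact: (W_sigmal based).
by rewrite (alpha_sigma_rho based) oppr_gt0.
Qed.

Lemma rprod_ascr j w : W w -> 0 < alpha j ((w^-1)%VF rho) ->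
  rprod (w \o sigma j)%VF = rprod w * T j.
Proof.
move=> Ww wj; rewrite -{1}(word_rex based Ww) -(word1 dot) -(word_cat dot).
rewrite rprod_word ?big_cat ?big_seq1 //.
rewrite /is_reduced word_cat word1 (word_rex based Ww) (len_ascr Ww) //.
by rewrite size_cat addn1.
Qed.

Lemma rprod_descr j w : W w -> alpha j ((w^-1)%VF rho) < 0 ->
  rprod w = rprod (w \o sigma j)%VF * T j.
Proof.
move=> Ww wj; rewrite -rprod_ascr ?(sigmaKr based) //; first exact: (W_sigmar based).
by rewrite inv_sigmar // (alpha_sigma_rho based) oppr_gt0.
Qed.

End ProductOverReducedWord.

Section Stabilizer.
Context (c : E) (c_dominant : forall j, 0 <= alpha j c).

Local Notation Wc := (stab dot Phi c).

Lemma stab_weyl w : Wc w -> W w. Proof. by case. Qed.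

Lemma stab1 : Wc \1%VF.
Proof. by split; [exact: weyl1 | rewrite id_lfunE]. Qed.

Lemma stab_comp w u : Wc w -> Wc u -> Wc (w \o u)%VF.
Proof.
by move=> [Ww wc] [Wu uc]; split; [exact: weyl_comp | rewrite comp_lfunE uc].
Qed.

Lemma stab_inv w : Wc w -> Wc (w^-1)%VF.
Proof.
move=> [Ww wc]; split; first exact: (weyl_inv Phi_root).
by rewrite -{1}wc (weylK Phi_root).
Qed.

Lemma stab_sigma j : alpha j c = 0 -> Wc (sigma j).
Proof.
by move=> jc; split; [exact: (W_sigma based) | rewrite reflE jc scale0r subr0].
Qed.

Lemma stab_finite : finite_set Wc.
Proof. by apply: sub_finite_set (weyl_finite Phi_root); apply: stab_weyl. Qed.

Lemma pos_dominant b : pos b -> 0 <= b c.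
Proof.
case=> _ [k ->]; rewrite sum_lfunE; apply: sumr_ge0 => i _.
by rewrite -scaler_nat scale_lfunE; apply: mulr_ge0; rewrite ?ler0n.
Qed.

(* A positive root vanishing at [c] only involves simple roots vanishing
   at [c]. *)
Lemma pos_root_stab b x : pos b -> b c = 0 ->
  (forall j, alpha j c = 0 -> 0 <= alpha j x) -> 0 <= b x.
Proof.
case=> _ [k ->]; rewrite !sum_lfunE => bc0 x0; apply: sumr_ge0 => i _.
have term_ge0 j : 0 <= (alpha j *+ k j) c.
  by rewrite -scaler_nat scale_lfunE; apply: mulr_ge0; rewrite ?ler0n.
have /eqP := bc0; rewrite psumr_eq0 => [/allP/(_ i)|j _ //].
rewrite mem_index_enum => /(_ isT) /=.
rewrite -!scaler_nat !scale_lfunE mulf_eq0 => /orP[/eqP ->|/eqP ic].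
  by rewrite scale0r.
by apply: mulr_ge0; rewrite ?ler0n ?x0.
Qed.

(** By [pos_root_stab] the value is nonnegative, and a root never vanishes at a point of the orbit
    of [rho]. *)
Lemma stab_asc b u : pos b -> b c = 0 -> W u ->
  (forall j, alpha j c = 0 -> 0 < alpha j (u rho)) -> 0 < b (u rho).
Proof.
move=> pb bc Wu ju; rewrite lt_neqAle pos_root_stab // => [|j /ju /ltW //].
rewrite andbT eq_sym -comp_lfunE; apply: (root_rho_neq0 based).
by apply: (root_weyl Phi_root) => //; case: pb.
Qed.

Lemma stab_desc b u : pos b -> b c = 0 -> W u ->
  (forall j, alpha j c = 0 -> alpha j (u rho) < 0) -> b (u rho) < 0.
Proof.
move=> pb bc Wu ju; have : 0 <= b (- u rho).
  by apply: pos_root_stab => // j /ju /ltW; rewrite linearN oppr_ge0.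
rewrite linearN oppr_ge0 => b_le0; rewrite lt_neqAle b_le0 andbT -comp_lfunE.
apply: (root_rho_neq0 based).
by apply: (root_weyl Phi_root) => //; case: pb.
Qed.

(** Any descent j of w will do: alpha_j \o w is then negative, so alpha_j c = alpha_j (w c) <= 0,
    while c is dominant. *)
Lemma stab_exists_desc w : Wc w -> w <> \1%VF ->
  exists2 j, alpha j c = 0 & alpha j (w rho) < 0.
Proof.
move=> [Ww wc] w1; have [j wj] : exists j, alpha j (w rho) < 0.
  apply: contrapT => /forallNP nj; apply: w1; apply: (no_descent based) => // j.
  by have [//|/nj] := alpha_rho_cases based j Ww.
exists j => //; apply/le_anti; rewrite c_dominant andbT -{1}wc -comp_lfunE.
have : 0 <= (- (alpha j \o w)%VF) c.
  apply: pos_dominant; apply: (neg_rho based); rewrite ?comp_lfunE //.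
  exact: (root_alpha_weyl based).
by rewrite opp_lfunE oppr_ge0.
Qed.

(** Expresses that W_c is a standard parabolic subgroup: its elements are reached from 1 by
    length-increasing multiplications with simple reflections that fix c. At c = 0 it is the
    induction used for W itself. *)
Lemma stab_ind (P : 'End(E) -> Prop) : P \1%VF ->
  (forall j w, Wc w -> alpha j c = 0 -> 0 < alpha j (w rho) ->
     P w -> P (sigma j \o w)%VF) ->
  forall w, Wc w -> P w.
Proof.
move=> P1 PS w; have [n] := ubnP (len w); elim: n w => // n IH w lw Wcw.
have [->//|w1] := pselect (w = \1%VF).
have [j jc wj] := stab_exists_desc Wcw w1; have Ww := stab_weyl Wcw.
have Wcjw : Wc (sigma j \o w)%VF by apply: stab_comp => //; apply: stab_sigma.
rewrite -(sigmaKl based j w); apply: PS => //.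
  by rewrite (alpha_sigma_rho based) oppr_gt0.
apply: IH => //; apply: leq_trans (len_desc_lt based Ww wj) _.
by rewrite -ltnS.
Qed.

Lemma stab_indr (P : 'End(E) -> Prop) : P \1%VF ->
  (forall j w, Wc w -> alpha j c = 0 -> 0 < alpha j ((w^-1)%VF rho) ->
     P w -> P (w \o sigma j)%VF) ->
  forall w, Wc w -> P w.
Proof.
move=> P1 PS w Wcw; rewrite -(weyl_invK Phi_root (stab_weyl Wcw)).
move: (w^-1)%VF (stab_inv Wcw) => {w Wcw}; apply: stab_ind.
  by rewrite inv1.
move=> j w Wcw jc wj Pw; rewrite inv_sigmal; last exact: stab_weyl.
apply: PS => //; first exact: stab_inv.
by rewrite (weyl_invK Phi_root) //; apply: stab_weyl.
Qed.

(** The form alpha_j \o v^-1 is a positive root vanishing at c, so [stab_asc] gives its sign at w^-1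
    rho. *)
Lemma stab_comp_asc j w v : W w -> Wc v -> alpha j c = 0 ->
  (forall j, alpha j c = 0 -> 0 < alpha j ((w^-1)%VF rho)) ->
  0 < alpha j ((v^-1)%VF rho) -> 0 < alpha j (((w \o v)^-1)%VF rho).
Proof.
move=> Ww Wcv jc wj vj; have Wv := stab_weyl Wcv.
have Wvi := weyl_inv Phi_root Wv; have Wwi := weyl_inv Phi_root Ww.
rewrite (weyl_inv_comp Phi_root) // comp_lfunE -(comp_lfunE (alpha j)).
apply: stab_asc => //.
  apply/(pos_rho based); rewrite ?comp_lfunE //.
  exact: (root_alpha_weyl based).
by rewrite comp_lfunE (stab_inv Wcv).2.
Qed.

Lemma stab_comp_desc j w v : W w -> Wc v -> alpha j c = 0 ->
  (forall j, alpha j c = 0 -> alpha j ((w^-1)%VF rho) < 0) ->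
  0 < alpha j ((v^-1)%VF rho) -> alpha j (((w \o v)^-1)%VF rho) < 0.
Proof.
move=> Ww Wcv jc wj vj; have Wv := stab_weyl Wcv.
have Wvi := weyl_inv Phi_root Wv; have Wwi := weyl_inv Phi_root Ww.
rewrite (weyl_inv_comp Phi_root) // comp_lfunE -(comp_lfunE (alpha j)).
apply: stab_desc => //.
  apply/(pos_rho based); rewrite ?comp_lfunE //.
  exact: (root_alpha_weyl based).
by rewrite comp_lfunE (stab_inv Wcv).2.
Qed.

Lemma len_comp_stab w v : W w ->
  (forall j, alpha j c = 0 -> 0 < alpha j ((w^-1)%VF rho)) -> Wc v ->
  len (w \o v)%VF = (len w + len v)%N.
Proof.
move=> Ww wj; move: v; apply: stab_indr => [|j v Wcv jc vj IH].
  by rewrite comp_lfun1r (len0 based) addn0.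
have Wv := stab_weyl Wcv; rewrite comp_lfunA !len_ascr ?IH ?addnS //.
  exact: weyl_comp.
exact: stab_comp_asc.
Qed.

Lemma longest_stab : Wc (longest dot alpha Wc) /\
  forall u, Wc u -> (len u <= len (longest dot alpha Wc))%N.
Proof.
apply: (@xgetPex _ \1%VF
  [set w | Wc w /\ forall u, Wc u -> (len u <= len w)%N]).
pose P n := `[< exists2 w, Wc w & len w = n >].
have exP : exists n, P n.
  by exists (len \1%VF); apply/asboolP; exists \1%VF => //; exact: stab1.
have leP n : P n -> (n <= \max_(w <- fset_set Wc) len w)%N.
  move=> /asboolP[w Wcw <-]; apply: leq_bigmax_seq => //.
  by rewrite in_fset_set ?inE //; apply: stab_finite.
case: (ex_maxnP exP leP) => n /asboolP[w Wcw <-] maxn.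
by exists w; split=> // u Wcu; apply: maxn; apply/asboolP; exists u.
Qed.

Local Notation w0c := (longest dot alpha Wc).

Lemma longest_descr j : alpha j c = 0 -> alpha j ((w0c^-1)%VF rho) < 0.
Proof.
move=> jc; have [Wcw0 maxw0] := longest_stab; have Ww0 := stab_weyl Wcw0.
have [wj|//] := alpha_rho_cases based j (weyl_inv Phi_root Ww0).
have := maxw0 _ (stab_comp Wcw0 (stab_sigma jc)).
by rewrite len_ascr // ltnn.
Qed.

Lemma longest_desc j : alpha j c = 0 -> alpha j (w0c rho) < 0.
Proof.
move=> jc; have [Wcw0 maxw0] := longest_stab; have Ww0 := stab_weyl Wcw0.
have [wj|//] := alpha_rho_cases based j Ww0.
have := maxw0 _ (stab_comp (stab_sigma jc) Wcw0).
by rewrite (len_asc based) // ltnn.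
Qed.

Section ProductOverReducedWord.
Context (A : pzRingType) (T : 'I_r -> A).
Context (braid : forall i j m,
  end_order (srefl dot alpha i \o srefl dot alpha j)%VF m ->
  \prod_(k <- braid_word i j m) T k = \prod_(k <- braid_word j i m) T k).

Lemma rprod_comp_stab w v : W w ->
  (forall j, alpha j c = 0 -> 0 < alpha j ((w^-1)%VF rho)) -> Wc v ->
  rprod T (w \o v)%VF = rprod T w * rprod T v.
Proof.
move=> Ww wj; move: v; apply: stab_indr => [|j v Wcv jc vj IH].
  by rewrite comp_lfun1r (rprod1 braid) mulr1.
have Wv := stab_weyl Wcv; rewrite comp_lfunA !(rprod_ascr braid) ?IH ?mulrA //.
  exact: weyl_comp.
exact: stab_comp_asc.
Qed.

(** The counterpart of [rprod_comp_stab] when every simple reflection of W_c shortens w on the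
    right: lengths then subtract, and w = (w v) v^-1 is a reduced factorization. *)
Lemma rprod_comp_stab_desc w v : W w ->
  (forall j, alpha j c = 0 -> alpha j ((w^-1)%VF rho) < 0) -> Wc v ->
  rprod T (w \o v)%VF * rprod T (v^-1)%VF = rprod T w.
Proof.
move=> Ww wj; move: v; apply: stab_indr => [|j v Wcv jc vj IH].
  by rewrite comp_lfun1r inv1 (rprod1 braid) mulr1.
have Wv := stab_weyl Wcv; rewrite inv_sigmar // (rprod_asc braid) //; last first.
  exact: (weyl_inv Phi_root).
rewrite comp_lfunA mulrA -(rprod_descr braid) //; first exact: weyl_comp.
exact: stab_comp_desc.
Qed.

End ProductOverReducedWord.
End Stabilizer.
End Parabolic.

(** * The longest element and minimal coset representatives *)

Section Cosets.
Context (R : realType) (E : vectType R) (dot : {dot E for idfun}).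
Context (Phi : set 'Hom(E, R^o)) (r : nat) (alpha : 'I_r -> 'Hom(E, R^o)).
Context (based : based_root_system dot Phi alpha).
Implicit Types (a b : 'Hom(E, R^o)) (i j k : 'I_r) (w u v : 'End(E)).

Local Notation W := (weyl dot Phi).
Local Notation len := (len dot alpha).
Local Notation sigma j := (refl dot (alpha j)).
Local Notation rho := (rho alpha).
Local Notation w0 := (longest dot alpha W).

Let Phi_root : root_system dot Phi. Proof. by case: based. Qed.

(** Lets every statement on stabilizers of dominant points be specialized to W, the case c = 0. *)
Lemma stab0 : stab dot Phi 0 = W.
Proof.
by apply/seteqP; split=> [w []//|w Ww]; split=> //; rewrite linear0.
Qed.

Let alpha0_ge0 j : 0 <= alpha j (0 : E). Proof. by rewrite linear0. Qed.

Lemma W_w0 : W w0.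
Proof. by rewrite -{2}stab0; have [[]] := longest_stab based (0 : E). Qed.

Lemma w0_desc j : alpha j (w0 rho) < 0.
Proof. by rewrite -stab0; apply: (longest_desc based); rewrite linear0. Qed.

Lemma w0_max w : W w -> (len w <= len w0)%N.
Proof.
by move=> Ww; rewrite -stab0; apply: (longest_stab based (0 : E)).2; rewrite stab0.
Qed.

Lemma w0_neg b : pos_roots Phi alpha b -> b (w0 rho) < 0.
Proof.
move=> pb; apply: (stab_desc based alpha0_ge0 pb) => //.
- exact: linear0.
- exact: W_w0.
- by move=> j _; apply: w0_desc.
Qed.

Lemma w0_involutive : (w0 \o w0)%VF = \1%VF.
Proof.
apply: (no_descent based); first exact: (weyl_comp W_w0 W_w0).
move=> j; rewrite -comp_lfunE comp_lfunA comp_lfunE.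
have nj : pos_roots Phi alpha (- (alpha j \o w0)%VF).
  apply: (neg_rho based); first exact: (root_alpha_weyl based j W_w0).
  by rewrite comp_lfunE; apply: w0_desc.
by have := w0_neg nj; rewrite opp_lfunE oppr_lt0.
Qed.

Lemma w0_comp_asc j u : W u ->
  (0 < alpha j (((w0 \o u)^-1)%VF rho)) = (alpha j ((u^-1)%VF rho) < 0).
Proof.
move=> Wu; have Wi := weyl_inv Phi_root Wu.
have w0i : (w0^-1)%VF = w0.
  apply: (weyl_injl Phi_root W_w0).
  by rewrite (weyl_compwV Phi_root W_w0) w0_involutive.
rewrite (weyl_inv_comp Phi_root W_w0 Wu) w0i comp_lfunE -(comp_lfunE (alpha j)).
have Pj := root_alpha_weyl based j Wi.
have [uj|uj] := alpha_rho_cases based j Wi.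
  rewrite [RHS]ltNge (ltW uj) /=; apply/negbTE; rewrite -leNgt ltW //.
  by apply: w0_neg; apply/(pos_rho based); rewrite ?comp_lfunE.
rewrite uj; have : (- (alpha j \o u^-1)%VF) (w0 rho) < 0.
  by apply/w0_neg/(neg_rho based); rewrite ?comp_lfunE.
by rewrite opp_lfunE oppr_lt0.
Qed.

Lemma w0_comp_desc j u : W u -> 0 < alpha j ((u^-1)%VF rho) ->
  alpha j (((w0 \o u)^-1)%VF rho) < 0.
Proof.
move=> Wu uj; have Wi := weyl_inv Phi_root (weyl_comp W_w0 Wu).
by case: (alpha_rho_cases based j Wi); rewrite // w0_comp_asc // ltNge (ltW uj).
Qed.

(* Since [- w0] permutes the positive roots additively, it maps indecomposable
   ones to indecomposable ones. *)
Lemma w0_alpha j : exists k, (alpha j \o w0)%VF = - alpha k.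
Proof.
have nj i : pos_roots Phi alpha (- (alpha i \o w0)%VF).
  apply: (neg_rho based); first exact: (root_alpha_weyl based i W_w0).
  by rewrite comp_lfunE; apply: w0_desc.
have [_ [k kE]] := nj j.
have h1 i : 1 <= - alpha i (w0 rho).
  by have := pos_rho_ge1 based (nj i); rewrite opp_lfunE comp_lfunE.
(* Evaluating at w0 rho and using that w0 is an involution, the coefficients k_i weighted by numbers
   >= 1 sum to alpha_j rho = 1; so exactly one k_i is 1 and the others vanish. *)
have sum1 : \sum_i (k i)%:R * - alpha i (w0 rho) = 1 :> R.
  have := congr1 (fun b : 'Hom(E, R^o) => b (w0 rho)) kE.
  rewrite opp_lfunE -comp_lfunE -comp_lfunA w0_involutive comp_lfun1r sum_lfunE.
  rewrite (alpha_rho based) => /(congr1 -%R); rewrite opprK -sumrN => sum1.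
  rewrite [RHS]sum1; apply: eq_bigr => i _; rewrite mulrN; congr (- _).
  by rewrite -[alpha i *+ k i]scaler_nat scale_lfunE.
have [i ki] : exists i, (0 < k i)%N.
  apply: contrapT => /forallNP k0; move: sum1; rewrite big1 => [/esym/eqP|i _].
    by rewrite oner_eq0.
  by have /negP := k0 i; rewrite -eqn0Ngt => /eqP ->; rewrite mul0r.
have term_ge l : (k l)%:R <= (k l)%:R * - alpha l (w0 rho) :> R.
  by rewrite ler_peMr ?ler0n.
have sum_le : (\sum_l k l <= 1)%N.
  rewrite -(ler_nat R) natr_sum; apply: le_trans (_ : 1 <= _); last by [].
  by rewrite -[X in _ <= X]sum1; apply: ler_sum => l _; apply: term_ge.
exists i; rewrite -[LHS]opprK kE (bigD1 i) //=.
move: sum_le; rewrite (bigD1 i) //= => sum_le.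
have [ki1 /eqP] : k i = 1%N /\ (\sum_(l | l != i) k l = 0)%N.
  by move: sum_le ki; move: (\sum_(l | l != i) k l)%N => S; lia.
rewrite sum_nat_eq0 => /forall_inP k0.
rewrite ki1 mulr1n big1 ?addr0 // => l li.
by rewrite (eqP (k0 l li)) mulr0n.
Qed.

Lemma w0_sigma j k : (alpha j \o w0)%VF = - alpha k ->
  (sigma j \o w0)%VF = (w0 \o sigma k)%VF.
Proof.
by move=> jk; rewrite (refl_comp _ (weyl_isometry Phi_root W_w0)) jk reflN.
Qed.

Lemma w0_sigma_comp j k w : (alpha j \o w0)%VF = - alpha k ->
  (w0 \o (sigma j \o w))%VF = (sigma k \o (w0 \o w))%VF.
Proof.
move=> jk; rewrite !comp_lfunA; congr (_ \o _)%VF.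
rewrite -[LHS]comp_lfun1r -w0_involutive comp_lfunA -(comp_lfunA w0).
by rewrite (w0_sigma jk) comp_lfunA w0_involutive comp_lfun1l.
Qed.

Lemma w0_coroot j k : (alpha j \o w0)%VF = - alpha k ->
  w0 (coroot dot (alpha k)) = - coroot dot (alpha j).
Proof.
move=> jk; rewrite -(coroot_comp (alpha j) (weyl_isometry Phi_root W_w0)) jk.
by rewrite corootN linearN opprK.
Qed.

Section Stabilizer.
Context (c : E) (c_dominant : forall j, 0 <= alpha j c).

Local Notation Wc := (stab dot Phi c).
Local Notation Wmin := (min_reps dot alpha Phi c).

Lemma min_reps_weyl w : Wmin w -> W w. Proof. by case. Qed.

Lemma min_reps_asc w j : Wmin w -> alpha j c = 0 -> 0 < alpha j ((w^-1)%VF rho).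
Proof.
move=> [Ww wmin] jc; have Wi := weyl_inv Phi_root Ww.
have [//|wj] := alpha_rho_cases based j Wi.
have := wmin _ (stab_sigma based jc).
by rewrite (len_descr based Ww wj) ltnn.
Qed.

Lemma min_reps_exists u : W u ->
  exists w v, [/\ Wmin w, Wc v & u = (w \o v)%VF].
Proof.
move=> Wu; pose P n := `[< exists2 v, Wc v & len (u \o v)%VF = n >].
have exP : exists n, P n.
  by exists (len (u \o \1)%VF); apply/asboolP; exists \1%VF => //; apply: stab1.
case: (ex_minnP exP) => n /asboolP[v Wcv <-] minn.
exists (u \o v)%VF, (v^-1)%VF; split.
- split; first by apply: weyl_comp => //; apply: stab_weyl Wcv.
  move=> v' Wcv'; apply: minn; apply/asboolP; exists (v \o v')%VF.
    exact: stab_comp.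
  by rewrite comp_lfunA.
- exact: (stab_inv based).
- by rewrite -comp_lfunA (weyl_compwV Phi_root (stab_weyl Wcv)) comp_lfun1r.
Qed.

Lemma min_reps_len w v : Wmin w -> Wc v -> len (w \o v)%VF = (len w + len v)%N.
Proof.
move=> wmin; apply: (len_comp_stab based c_dominant (min_reps_weyl wmin)) => j.
exact: min_reps_asc.
Qed.

(** With u = v' v^-1 one has w = w' u and l(w) = l(w') + l(u), while minimality of w gives l(w) <=
    l(w'); hence u = 1. *)
Lemma min_reps_unique w w' v v' : Wmin w -> Wmin w' -> Wc v -> Wc v' ->
  (w \o v)%VF = (w' \o v')%VF -> w = w' /\ v = v'.
Proof.
move=> wm wm' Wcv Wcv' eqwv; have Wv := stab_weyl Wcv; have Wv' := stab_weyl Wcv'.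
have Wcu : Wc (v' \o v^-1)%VF by apply: stab_comp => //; apply: (stab_inv based).
have wE : w = (w' \o (v' \o v^-1))%VF.
  by rewrite comp_lfunA -eqwv -comp_lfunA (weyl_compwV Phi_root Wv) comp_lfun1r.
have lw := min_reps_len wm' Wcu; rewrite -wE in lw.
have u1 : (v' \o v^-1)%VF = \1%VF.
  apply: (len_eq0 based); first exact: stab_weyl Wcu.
  have [_ /(_ _ (stab_inv based Wcu))] := wm.
  rewrite {2}wE -comp_lfunA (weyl_compwV Phi_root (stab_weyl Wcu)) comp_lfun1r lw.
  by lia.
rewrite u1 comp_lfun1r in wE; split=> //.
by apply: (weyl_injl Phi_root (min_reps_weyl wm)); rewrite eqwv wE.
Qed.

Lemma min_reps_finite : finite_set Wmin.
Proof. by apply: sub_finite_set (weyl_finite Phi_root); apply: min_reps_weyl. Qed.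

Lemma sum_min_reps (V : nmodType) (G : 'End(E) -> V) :
  \sum_(u \in W) G u = \sum_(w \in Wmin) \sum_(v \in Wc) G (w \o v)%VF.
Proof.
rewrite pair_fsbig; [|exact: min_reps_finite|exact: (stab_finite based)].
apply: (@reindex_fsbig _ _ _ _ _ (fun p : 'End(E) * 'End(E) => (p.1 \o p.2)%VF)).
split=> [[w v] [/= wm Wcv]|[w v] [w' v']|u Wu].
- by apply: weyl_comp; [exact: min_reps_weyl | exact: stab_weyl Wcv].
- rewrite !inE => -[/= wm Wcv] [/= wm' Wcv'] eqwv.
  by have [-> ->] := min_reps_unique wm wm' Wcv Wcv' eqwv.
- by have [w [v [wm Wcv ->]]] := min_reps_exists Wu; exists (w, v).
Qed.

Lemma sum_stab_mull (V : nmodType) (G : 'End(E) -> V) u : Wc u ->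
  \sum_(v \in Wc) G v = \sum_(v \in Wc) G (u \o v)%VF.
Proof.
move=> Wcu; apply: reindex_fsbig; split=> [v|v v' _ _|v] Wcv.
- exact: stab_comp.
- exact: (weyl_injl Phi_root (stab_weyl Wcu)) Wcv.
- exists (u^-1 \o v)%VF; first by apply: stab_comp => //; apply: (stab_inv based).
  by rewrite comp_lfunA (weyl_compwV Phi_root (stab_weyl Wcu)) comp_lfun1l.
Qed.

Lemma sum_stab_mulr (V : nmodType) (G : 'End(E) -> V) u : Wc u ->
  \sum_(v \in Wc) G v = \sum_(v \in Wc) G (v \o u)%VF.
Proof.
move=> Wcu; apply: (reindex_fsbig (fun v => v \o u)%VF).
split=> [v|v v' _ _|v] Wcv.
- exact: stab_comp.
- exact: (weyl_injr Phi_root (stab_weyl Wcu)) Wcv.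
- exists (v \o u^-1)%VF; first by apply: stab_comp => //; apply: (stab_inv based).
  by rewrite -comp_lfunA (weyl_compVw Phi_root (stab_weyl Wcu)) comp_lfun1r.
Qed.

End Stabilizer.
End Cosets.

(** * The lattice and the operators nabla *)

Section Lattice.
Context (R : realType) (E : vectType R) (dot : {dot E for idfun}).
Context (Phi : set 'Hom(E, R^o)) (r : nat) (alpha : 'I_r -> 'Hom(E, R^o)).
Context (based : based_root_system dot Phi alpha).
Context (Lambda : set E) (Lambda_adm : admissible_lattice dot Phi Lambda).
Implicit Types (a b : 'Hom(E, R^o)) (j k : 'I_r) (w : 'End(E)) (x y z : E).

Local Notation W := (weyl dot Phi).
Local Notation sigma j := (refl dot (alpha j)).
Local Notation w0 := (longest dot alpha W).

Let Phi_root : root_system dot Phi. Proof. by case: based. Qed.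

Lemma zspanB (A : set E) y z : zspan A y -> zspan A z -> zspan A (y - z).
Proof.
move=> [n [v [m [Av ->]]]] [n' [v' [m' [Av' ->]]]].
exists (n + n')%N, (fun i => match fintype.split i with inl i => v i | inr i => v' i end).
exists (fun i => match fintype.split i with inl i => m i | inr i => - m' i end).
split=> [i|]; first by case: (fintype.split i).
rewrite big_split_ord /= -sumrN; congr (_ + _); apply: eq_bigr => i _.
  by rewrite (unsplitK (inl i)).
by rewrite (unsplitK (inr i)) mulrNz.
Qed.

Lemma latticeB y z : Lambda y -> Lambda z -> Lambda (y - z).
Proof. by case: Lambda_adm => -[A _ ->] _ _; apply: zspanB. Qed.

Lemma lattice0 : Lambda 0.
Proof.
case: Lambda_adm => -[A _ ->] _ _; exists 0%N, (fun=> 0), (fun=> 0).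
by split=> [[]//|]; rewrite big_ord0.
Qed.

Lemma latticeN y : Lambda y -> Lambda (- y).
Proof. by rewrite -sub0r; apply: latticeB; apply: lattice0. Qed.

Lemma latticeD y z : Lambda y -> Lambda z -> Lambda (y + z).
Proof. by move=> Ly Lz; rewrite -[z]opprK; apply: latticeB => //; apply: latticeN. Qed.

Lemma latticeMn y n : Lambda y -> Lambda (y *+ n).
Proof.
move=> Ly; elim: n => [|n IH]; first by rewrite mulr0n; exact: lattice0.
by rewrite mulrS; apply: latticeD.
Qed.

Lemma latticeMz y (m : int) : Lambda y -> Lambda (y *~ m).
Proof.
move=> Ly; case: m => n; first exact: latticeMn.
by rewrite NegzE mulrNz; apply: latticeN; apply: latticeMn.
Qed.

Lemma lattice_coroot a : Phi a -> Lambda (coroot dot a).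
Proof.
case: Lambda_adm => _ sub _ Pa; apply: sub.
exists 1%N, (fun=> coroot dot a), (fun=> 1).
by split=> [_|]; [exists a | rewrite big_ord1].
Qed.

Lemma lattice_int a y : Phi a -> Lambda y -> exists m : int, a y = m%:~R.
Proof.
by case: Lambda_adm => _ _ int Pa Ly; have /intrP[m ->] := int a y Pa Ly; exists m.
Qed.

Lemma lattice_weyl w y : W w -> Lambda y -> Lambda (w y).
Proof.
move=> + Ly; move: w; apply: weyl_ind => [|a w Pa _ Lwy]; first by rewrite id_lfunE.
rewrite comp_lfunE reflE; have [m ->] := lattice_int Pa Lwy.
by rewrite scaler_int; apply/latticeB/latticeMz => //; apply: lattice_coroot.
Qed.

Lemma lattice_alpha_coroot j : Lambda (coroot dot (alpha j)).
Proof. by apply: lattice_coroot; apply: (alpha_root based). Qed.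

Section Nabla.
Context (F : fieldType).
Implicit Types (f g : {malg F[E]}).

Local Notation den j := (den dot alpha F j).
Local Notation nabla := (nabla dot alpha (F := F)).

Lemma supported_weyl w f : W w -> supported Lambda f -> supported Lambda (wact w f).
Proof. by move=> Ww; apply: supported_wact => y; apply: lattice_weyl. Qed.

Lemma supported_lattice_iota f : supported Lambda f -> supported Lambda (iota_inv f).
Proof. by apply: supported_iota => y; apply: latticeN. Qed.

Lemma coroot_alpha_neq0 j : coroot dot (alpha j) != 0.
Proof. by apply: coroot_neq0; apply: (root_neq0 Phi_root); apply: (alpha_root based). Qed.

(** The quotient is minus a geometric sum, over x^(y - k a) with 1 <= k <= n and a the coroot of
    alpha_j. *)
Lemma den_dvd_basis j y (n : nat) : Lambda y -> exists2 g, supported Lambda g &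
  gmul g (den j) = << (y - coroot dot (alpha j) *+ n) >> - << y >>.
Proof.
elim: n y => [|n IH] y Ly.
  by exists 0; [exact: supported0 | rewrite gmul0l mulr0n subr0 subrr].
have Ly' : Lambda (y - coroot dot (alpha j)).
  by apply: latticeB => //; apply: lattice_alpha_coroot.
have [g Lg gE] := IH _ Ly'; exists (g - << (y - coroot dot (alpha j)) >>).
  by apply: supportedB => //; apply: supported_basis.
rewrite gmulBl gE /Defs.den /cor linearB /= !gmul_basis subrK addr0.
by rewrite opprB addrA subrK mulrS opprD addrA.
Qed.

Lemma den_dvd_sigma j f : supported Lambda f -> exists2 g, supported Lambda g &
  gmul g (den j) = wact (sigma j) f - f.
Proof.
move: f; apply: supported_ind => [|q y f Ly _ [g Lg gE]].
  by exists 0; [exact: supported0 | rewrite gmul0l linear0 subrr].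
have Pj := alpha_root based j.
suff [h Lh hE] : exists2 h, supported Lambda h &
    gmul h (den j) = << (sigma j y) >> - << y >>.
  exists (q *: h + g); first by apply: supportedD => //; apply: supportedZ.
  rewrite gmulDl gmulZl hE gE linearP /= wact_basis scalerBr.
  by rewrite opprD addrACA.
rewrite reflE; have [m ->] := lattice_int Pj Ly; rewrite scaler_int.
case: m => n; first exact: den_dvd_basis.
(* For a negative value of alpha_j at y, the geometric sum starts at s_j y and runs back to y, which
   accounts for the sign of the quotient. *)
have Ly' : Lambda (y + coroot dot (alpha j) *+ n.+1).
  by apply/latticeD/latticeMn => //; apply: lattice_alpha_coroot.
have [h Lh hE] := den_dvd_basis j n.+1 Ly'; exists (- h); first exact: supportedN.
by rewrite gmulNl hE addrK opprB NegzE mulrNz opprK.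
Qed.

Lemma nabla_unique j f g : gmul g (den j) = wact (sigma j) f - f -> nabla j f = g.
Proof. by apply: gdivP; apply: coroot_alpha_neq0. Qed.

Lemma nablaP j f : supported Lambda f ->
  gmul (nabla j f) (den j) = wact (sigma j) f - f.
Proof. by move=> /(den_dvd_sigma j)[g _ gE]; rewrite (nabla_unique gE). Qed.

Lemma supported_nabla j f : supported Lambda f -> supported Lambda (nabla j f).
Proof. by move=> /(den_dvd_sigma j)[g Lg gE]; rewrite (nabla_unique gE). Qed.

Lemma nabla0 j : nabla j 0 = 0.
Proof. by apply: nabla_unique; rewrite gmul0l linear0 subrr. Qed.

Lemma nabla_linear j (q : F) f g : supported Lambda f -> supported Lambda g ->
  nabla j (q *: f + g) = q *: nabla j f + nabla j g.
Proof.
move=> Lf Lg; apply: nabla_unique; rewrite gmulDl gmulZl !nablaP // linearP /=.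
by rewrite scalerBr opprD addrACA.
Qed.

(** For a the coroot of alpha_j, s_j maps x^a - 1 to - x^(-a) (x^a - 1), so that s_j nabla_j f = x^a
    nabla_j f = nabla_j f + (x^a - 1) nabla_j f. *)
Lemma sigma_nabla j f : supported Lambda f ->
  wact (sigma j) (nabla j f) = nabla j f + (wact (sigma j) f - f).
Proof.
move=> Lf; pose a := coroot dot (alpha j).
have sa : sigma j a = - a.
  rewrite reflE coroot_self; last exact/(root_neq0 Phi_root)/(alpha_root based).
  by rewrite scaler_nat mulr2n opprD addrA subrr sub0r.
have sden : wact (sigma j) (den j) = - gmul << (- a) >> (den j) :> {malg F[E]}.
  rewrite /Defs.den /cor !linearB /= !gmul_basis !wact_basis linear0 sa.
  by rewrite addNr addr0 opprK addrC.
have ss : wact (sigma j) (wact (sigma j) f) = f.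
  by rewrite wact_comp (sigmaK based) wact_id.
apply/eqP; rewrite -subr_eq0; apply/eqP/(gmul_den_inj (coroot_alpha_neq0 j)).
rewrite -[_ - << 0 >>]/(den j) gmulBl gmulDl nablaP //.
set D := wact (sigma j) f - f; set N := wact _ (nabla j f).
have DE : gmul D (den j) = gmul << a >> D - D.
  by rewrite gmulC gmulBl gmul_unitl.
have : gmul N (wact (sigma j) (den j)) = - D.
  by rewrite -wact_gmul nablaP // linearB /= ss opprB.
rewrite sden linearN /= => /oppr_inj; rewrite gmulC -gmulA.
move=> /(congr1 (gmul << a >>)); rewrite gmulA gmul_basis subrr gmul_unitl gmulC => ->.
by rewrite DE [D + _]addrC subrK subrr.
Qed.

(** w0 sends the coroot of alpha_k to minus that of alpha_j and [iota_inv] undoes the sign, so that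
    together they carry one denominator to the other. *)
Lemma nabla_iota_w0 j k f : (alpha j \o w0)%VF = - alpha k ->
  supported Lambda f ->
  nabla j (iota_inv (wact w0 f)) = iota_inv (wact w0 (nabla k f)).
Proof.
move=> jk Lf; apply: nabla_unique.
have -> : den j = iota_inv (wact w0 (den k)).
  rewrite /Defs.den /cor !linearB /= !wact_basis !iota_inv_basis linear0 oppr0.
  by rewrite (w0_coroot based jk) opprK.
rewrite -iota_gmul -wact_gmul nablaP // !linearB /= -iota_wact !wact_comp.
by rewrite (w0_sigma based jk).
Qed.

End Nabla.
End Lattice.

(** * Points of the fundamental alcove *)

Section AlcovePoints.
Context (R : realType) (E : vectType R) (dot : {dot E for idfun}).
Context (Phi : set 'Hom(E, R^o)) (r : nat) (alpha : 'I_r -> 'Hom(E, R^o)).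
Context (based : based_root_system dot Phi alpha).
Context (Lambda : set E) (Lambda_adm : admissible_lattice dot Phi Lambda).
Implicit Types (a b : 'Hom(E, R^o)) (j k : 'I_r) (w u v : 'End(E)).
Implicit Types (c x y z : E).

Local Notation W := (weyl dot Phi).
Local Notation len := (len dot alpha).
Local Notation sigma j := (refl dot (alpha j)).
Local Notation rho := (rho alpha).
Local Notation C0 := (C0 dot alpha Phi Lambda).

Let Phi_root : root_system dot Phi. Proof. by case: based. Qed.

Lemma C0_dominant c : C0 c -> forall j, 0 <= alpha j c.
Proof. by move=> [+ _] j => /(_ _ (pos_alpha based j)) /andP[]. Qed.

Lemma C0_stab c w y : C0 c -> W w -> Lambda y -> w c + y = c ->
  stab dot Phi c w /\ y = 0.
Proof.
move=> [_ eqC] Ww Ly wcy.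
have : [set p : 'End(E) * E | [/\ W p.1, Lambda p.2 & p.1 c + p.2 = c]] (w, y).
  by split.
by rewrite eqC => -[].
Qed.

(** Applying u^-1 to the relation gives an affine map with linear part u^-1 w that fixes c; by the
    choice of c its translation part is zero. *)
Lemma C0_coset c w u : C0 c -> W w -> W u -> Lambda (w c - u c) -> w c = u c.
Proof.
move=> Cc Ww Wu Lwu; have Wui := weyl_inv Phi_root Wu.
have := @C0_stab c (u^-1 \o w)%VF (- (u^-1%VF (w c - u c))) Cc.
case=> [|||[_ uw] _].
- exact: weyl_comp.
- by apply: (latticeN Lambda_adm); apply: (lattice_weyl Lambda_adm).
- by rewrite comp_lfunE linearB /= (weylK Phi_root Wu) opprB addrC subrK.
- by rewrite -{2}uw comp_lfunE (weylVK Phi_root Wu).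
Qed.

(** If b c = 1, then c is fixed by the affine reflection in the hyperplane b = 1, whose translation
    part is the coroot of b, a nonzero element of Lambda. *)
Lemma C0_root c b : C0 c -> pos_roots Phi alpha b -> b c != 0 -> 0 < b c < 1.
Proof.
move=> Cc pb bc0; have Pb : Phi b by case: pb.
have /andP[b0 b1] := Cc.1 _ pb; rewrite lt_neqAle eq_sym bc0 b0 /=.
rewrite lt_neqAle b1 andbT; apply/eqP => bc1.
have := coroot_neq0 dot (root_neq0 Phi_root Pb).
have := @C0_stab c (refl dot b) (coroot dot b) Cc (weyl_refl dot Pb).
case=> [||_ ->]; last by rewrite eqxx.
- exact: (lattice_coroot Lambda_adm).
- by rewrite reflE bc1 scale1r subrK.
Qed.

(* A small multiple of [rho] : all roots take values of absolute value less
   than 1/2 there, whereas they are integral on [Lambda]. *)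
Lemma regular_C0_exists : exists2 c, C0 c &
  forall w, stab dot Phi c w -> w = \1%VF.
Proof.
have [Phi_fin _ _ _] := Phi_root.
(* [S] bounds all the values |a rho|, and the summand 1 in [e] makes e S < 1/2 strict. *)
pose S : R := \sum_(a \in Phi) `|a rho : R|.
have S0 : 0 <= S by apply: fsumr_ge0 => a _; apply: normr_ge0.
pose e : R := (2 * (1 + S))^-1.
have e0 : 0 < e by rewrite invr_gt0 mulr_gt0 ?ltr0n // ltr_pwDl.
have small a : Phi a -> `|a (e *: rho) : R| < 2^-1.
  move=> Pa; have aS : `|a rho : R| <= S.
    rewrite /S (fsbigD1 a) //= lerDl.
    by apply: fsumr_ge0 => b _; apply: normr_ge0.
  rewrite formZ normrM gtr0_norm //.
  apply: le_lt_trans (_ : e * S < _); first by rewrite ler_pM2l.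
  rewrite /e invfM -mulrA gtr_pMr ?invr_gt0 ?ltr0n // mulrC ltr_pdivrMr ?mul1r.
    by rewrite ltrDr ltr01.
  by rewrite ltr_pwDl.
have eq_c w y : W w -> Lambda y -> w (e *: rho) + y = e *: rho ->
    w (e *: rho) = e *: rho.
  move=> Ww Ly wy; have W1 : W \1%VF by apply: weyl1.
  suff /(weyl_eq Ww W1) : forall a, Phi a ->
    a (w (e *: rho)) = a (\1%VF (e *: rho)) by rewrite id_lfunE.
  move=> a Pa.
  have yE : y = e *: rho - w (e *: rho) by rewrite -[X in X - _]wy addrC addKr.
  have [m am] := lattice_int Lambda_adm Pa Ly.
  have /small aw := root_weyl Phi_root Ww Pa; have ae := small a Pa.
  have : `|m%:~R : R| < 1.
    rewrite -am yE linearB -[X in _ < X](_ : 2^-1 + 2^-1 = 1); last by field.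
    apply: le_lt_trans (ler_normB _ _) _; apply: ltrD => //.
    by move: aw; rewrite comp_lfunE.
  rewrite -intr_norm ltrz1 => m1; have m0 : m = 0 by lia.
  move: am; rewrite m0 yE linearB => /eqP; rewrite subr_eq0 /= => /eqP <-.
  by rewrite id_lfunE.
exists (e *: rho).
  split=> [a pa|].
    have Pa : Phi a by case: pa.
    have := small a Pa; rewrite formZ.
    have a0 : 0 < e * a rho by rewrite mulr_gt0 //; apply/(pos_rho based).
    rewrite gtr0_norm // (ltW a0) /= => /ltW /le_trans; apply.
    by rewrite invf_le1 ?ler1n ?ltr0n.
  apply/seteqP; split=> -[w y] /= => [[Ww Ly wy]|[[Ww wc] ->]].
    have wc := eq_c _ _ Ww Ly wy; split=> //.
    by move: wy; rewrite wc => /(canRL (addKr _)); rewrite addNr.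
  by split; rewrite ?addr0 //; exact: (lattice0 Lambda_adm).
move=> w [Ww]; rewrite linearZ => /(scalerI (lt0r_neq0 e0)) wr.
by apply: (no_descent based) => // j; rewrite wr (alpha_rho based) ltr01.
Qed.

Lemma min_reps_sigma c j w : W w -> 0 < alpha j (w rho) ->
  min_reps dot alpha Phi c (sigma j \o w)%VF -> min_reps dot alpha Phi c w.
Proof.
move=> Ww wj [_ wmin]; split=> // u Wcu; rewrite -ltnS -(len_asc based Ww wj).
apply: leq_trans (wmin u Wcu) _; rewrite -comp_lfunA.
by apply: (len_sigma_le based); apply: weyl_comp => //; apply: stab_weyl Wcu.
Qed.

(** If alpha_j (w c) = 0, the reflection in alpha_j \o w fixes c, and s_j w is w times this
    reflection; then w is a shorter element of the same coset. *)
Lemma min_reps_sigma_neq0 c j w : W w -> 0 < alpha j (w rho) ->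
  min_reps dot alpha Phi c (sigma j \o w)%VF -> alpha j (w c) != 0.
Proof.
move=> Ww wj [_ wmin]; apply/eqP => wjc.
have Pb := root_alpha_weyl based j Ww.
have Wcb : stab dot Phi c (refl dot (alpha j \o w)%VF).
  by split; [exact: (weyl_refl dot) | rewrite reflE comp_lfunE wjc scale0r subr0].
have := wmin _ Wcb; rewrite (refl_comp _ (weyl_isometry Phi_root Ww)) -comp_lfunA.
rewrite reflK ?comp_lfun1r; last exact: (root_neq0 Phi_root).
rewrite -(refl_comp _ (weyl_isometry Phi_root Ww)) (len_asc based Ww wj).
by rewrite ltnn.
Qed.

End AlcovePoints.

(** * The Hecke algebra *)

Section HeckeAlgebra.
Context (R : realType) (E : vectType R) (dot : {dot E for idfun}).
Context (Phi : set 'Hom(E, R^o)) (r : nat) (alpha : 'I_r -> 'Hom(E, R^o)).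
Context (based : based_root_system dot Phi alpha).
Context (F : fieldType) (t : 'Hom(E, R^o) -> F) (t_inv : W_invariant dot Phi t).
Context (Lambda : set E) (Lambda_adm : admissible_lattice dot Phi Lambda).
Context (H : unitAlgType F) (T : 'I_r -> H) (X : E -> H).
Context (relations : hecke_relations dot alpha t Lambda T X).
Context (pi : H -> {malg F[E]} -> {malg F[E]}).
Context (pi_rep : polynomial_rep dot alpha t Lambda T X pi).
Implicit Types (i j k : 'I_r) (w u v : 'End(E)) (x y z c : E).
Implicit Types (f g : {malg F[E]}) (h : H).

Local Notation W := (weyl dot Phi).
Local Notation len := (len dot alpha).
Local Notation sigma j := (refl dot (alpha j)).
Local Notation rho := (rho alpha).
Local Notation TW := (Tw dot alpha T).
Local Notation tW := (tw dot alpha t).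
Local Notation tj j := (t (alpha j)).
Local Notation nabla := (nabla dot alpha (F := F)).
Local Notation w0 := (longest dot alpha W).

Let Phi_root : root_system dot Phi. Proof. by case: based. Qed.

Definition tdiff j : F := tj j - (tj j)^-1.

Lemma mulr_fsumr_fin (A : pzRingType) (I : choiceType) (P : set I) (G : I -> A) a :
  finite_set P -> a * (\sum_(i \in P) G i) = \sum_(i \in P) a * G i.
Proof. by move=> Pfin; rewrite !fsbig_finite // mulr_sumr. Qed.

Lemma mulr_fsuml_fin (A : pzRingType) (I : choiceType) (P : set I) (G : I -> A) a :
  finite_set P -> (\sum_(i \in P) G i) * a = \sum_(i \in P) G i * a.
Proof. by move=> Pfin; rewrite !fsbig_finite // mulr_suml. Qed.

Lemma scaler_fsum (V : lmodType F) (I : choiceType) (P : set I) (G : I -> V) a :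
  finite_set P -> a *: (\sum_(i \in P) G i) = \sum_(i \in P) a *: G i.
Proof. by move=> Pfin; rewrite !fsbig_finite // scaler_sumr. Qed.

Lemma tj_neq0 j : tj j != 0.
Proof. by apply: t_inv.1; apply: (alpha_root based). Qed.

Lemma T_braid i j m : end_order (srefl dot alpha i \o srefl dot alpha j)%VF m ->
  \prod_(k <- braid_word i j m) T k = \prod_(k <- braid_word j i m) T k.
Proof. by case: relations => + _ _ _ _; apply. Qed.

Lemma T_sqr j : T j * T j = tdiff j *: T j + 1.
Proof.
have [_ /(_ j) Tq _ _ _] := relations.
apply/eqP; rewrite -subr_eq0 -[X in _ == X]Tq mulrDr !mulrBl !mulr_algl !mulr_algr.
rewrite scalerA mulfV ?tj_neq0 // scale1r /tdiff scalerBl opprD opprB.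
by apply/eqP; rewrite [_ - tj j *: _]addrC !addrA.
Qed.

Lemma T_mulV j : T j * (T j - (tdiff j)%:A) = 1.
Proof. by rewrite mulrBr T_sqr mulr_algr addrC addKr. Qed.

Lemma T_Vmul j : (T j - (tdiff j)%:A) * T j = 1.
Proof. by rewrite mulrBl T_sqr mulr_algl addrC addKr. Qed.

Lemma T_unit j : T j \is a GRing.unit.
Proof.
by apply/unitrP; exists (T j - (tdiff j)%:A); rewrite T_mulV T_Vmul.
Qed.

Lemma T_inv j : (T j)^-1 = T j - (tdiff j)%:A.
Proof. by apply: (mulrI (T_unit j)); rewrite mulrV ?T_unit // T_mulV. Qed.

Lemma pi_T j f : supported Lambda f ->
  pi (T j) f = tj j *: wact (sigma j) f + tdiff j *: nabla j f.
Proof. by case: pi_rep => _ _; apply. Qed.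

Lemma supported_pi h f : supported Lambda f -> supported Lambda (pi h f).
Proof. by case: pi_rep => -[Lpi _ _ _ _] _ _; apply: Lpi. Qed.

Lemma piM h h' f : supported Lambda f -> pi (h * h') f = pi h (pi h' f).
Proof. by case: pi_rep => -[_ _ _ _ piM] _ _; apply: piM. Qed.

Lemma pi1 f : supported Lambda f -> pi 1 f = f.
Proof. by case: pi_rep => -[_ _ _ pi1 _] _ _; apply: pi1. Qed.

Lemma pi_linearr h (a : F) f g : supported Lambda f -> supported Lambda g ->
  pi h (a *: f + g) = a *: pi h f + pi h g.
Proof. by case: pi_rep => -[_ piD _ _ _] _ _; apply: piD. Qed.

Lemma pi_linearl (a : F) h h' f : supported Lambda f ->
  pi (a *: h + h') f = a *: pi h f + pi h' f.
Proof. by case: pi_rep => -[_ _ piD _ _] _ _; apply: piD. Qed.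

Lemma piD h h' f : supported Lambda f -> pi (h + h') f = pi h f + pi h' f.
Proof. by move=> Lf; rewrite -[h]scale1r pi_linearl // !scale1r. Qed.

Lemma pi0 f : supported Lambda f -> pi 0 f = 0.
Proof.
by move=> Lf; apply: (addrI (pi 0 f)); rewrite -piD // !addr0.
Qed.

Lemma piZl (a : F) h f : supported Lambda f -> pi (a *: h) f = a *: pi h f.
Proof. by move=> Lf; rewrite -[a *: h]addr0 pi_linearl // pi0 // addr0. Qed.

Lemma piZr h (a : F) f : supported Lambda f -> pi h (a *: f) = a *: pi h f.
Proof.
move=> Lf; rewrite -[a *: f]addr0 pi_linearr //; last exact: supported0.
suff -> : pi h 0 = 0 by rewrite addr0.
have := pi_linearr h 1 (@supported0 _ _ _ Lambda) (@supported0 _ _ _ Lambda).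
rewrite !scale1r addr0 => /eqP; rewrite -subr_eq0 opprD addrA subrr add0r oppr_eq0.
by move=> /eqP.
Qed.

(* The constants span a one-dimensional representation [T j |-> t_j] of the
   finite Hecke algebra, so the parameters inherit the braid relations. *)
Lemma pi_prod_one s :
  pi (\prod_(k <- s) T k) << 0 >> = (\prod_(k <- s) tj k) *: << 0 >>.
Proof.
have L1 : supported Lambda (<< 0 >> : {malg F[E]}).
  by apply: supported_basis; exact: (lattice0 Lambda_adm).
elim: s => [|j s IH]; first by rewrite !big_nil pi1 // scale1r.
rewrite !big_cons piM // IH piZr // pi_T // wact_basis linear0.
rewrite (nabla_unique based (g := 0)); last first.
  by rewrite gmul0l wact_basis linear0 subrr.
by rewrite scaler0 addr0 scalerA mulrC.
Qed.

Lemma t_braid i j m : end_order (srefl dot alpha i \o srefl dot alpha j)%VF m ->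
  \prod_(k <- braid_word i j m) tj k = \prod_(k <- braid_word j i m) tj k.
Proof.
move=> /T_braid /(congr1 (fun h => (pi h << 0 >>)@_0)).
by rewrite !pi_prod_one !mcoeffZ !mcoeffUU !mulr1.
Qed.

Lemma tW_asc j w : W w -> 0 < alpha j (w rho) -> tW (sigma j \o w)%VF = tj j * tW w.
Proof. exact: (rprod_asc based t_braid). Qed.

Lemma tW_desc j w : W w -> alpha j (w rho) < 0 -> tW w = tj j * tW (sigma j \o w)%VF.
Proof. exact: (rprod_desc based t_braid). Qed.

Lemma tW_ascr j w : W w -> 0 < alpha j ((w^-1)%VF rho) ->
  tW (w \o sigma j)%VF = tW w * tj j.
Proof. exact: (rprod_ascr based t_braid). Qed.

Lemma tW_neq0 w : tW w != 0.
Proof.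
rewrite /tw; elim: (rex _ _ _) => [|j s IH]; first by rewrite big_nil oner_neq0.
by rewrite big_cons mulf_neq0 ?tj_neq0.
Qed.

Lemma tW1 : tW \1%VF = 1. Proof. exact: (rprod1 based t_braid). Qed.

Lemma tW_inv w : W w -> tW (w^-1)%VF = tW w.
Proof.
rewrite -{1}(stab0 dot Phi).
move: w; apply: (stab_ind based) => [j||j w []]; first by rewrite linear0.
  by rewrite (inv1 based).
move=> Ww _ _ wj IH; rewrite (inv_sigmal based) // tW_asc // -IH.
rewrite tW_ascr ?(weyl_invK Phi_root) // ; last exact: (weyl_inv Phi_root).
by rewrite mulrC.
Qed.

Lemma Tw1 : TW \1%VF = 1. Proof. exact: (rprod1 based T_braid). Qed.

Lemma Tw_asc j w : W w -> 0 < alpha j (w rho) -> TW (sigma j \o w)%VF = T j * TW w.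
Proof. exact: (rprod_asc based T_braid). Qed.

Lemma Tw_desc j w : W w -> alpha j (w rho) < 0 -> TW w = T j * TW (sigma j \o w)%VF.
Proof. exact: (rprod_desc based T_braid). Qed.

Lemma Tw_ascr j w : W w -> 0 < alpha j ((w^-1)%VF rho) ->
  TW (w \o sigma j)%VF = TW w * T j.
Proof. exact: (rprod_ascr based T_braid). Qed.

Lemma Tw_descr j w : W w -> alpha j ((w^-1)%VF rho) < 0 ->
  TW w = TW (w \o sigma j)%VF * T j.
Proof. exact: (rprod_descr based T_braid). Qed.

Lemma Tw_unit w : TW w \is a GRing.unit.
Proof.
rewrite /Tw; elim: (rex _ _ _) => [|j s IH]; rewrite ?big_nil ?unitr1 //.
by rewrite big_cons unitrMl ?T_unit.
Qed.

Lemma Tw_mull j w : W w -> T j * TW w =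
  TW (sigma j \o w)%VF + (if alpha j (w rho) < 0 then tdiff j else 0) *: TW w.
Proof.
move=> Ww; have [wj|wj] := alpha_rho_cases based j Ww.
  by rewrite ltNge (ltW wj) /= scale0r addr0 -Tw_asc.
rewrite wj (Tw_desc Ww wj).
by rewrite mulrA T_sqr mulrDl mul1r addrC scalerAl.
Qed.

Lemma Tw_mulr j w : W w -> TW w * T j = TW (w \o sigma j)%VF +
  (if alpha j ((w^-1)%VF rho) < 0 then tdiff j else 0) *: TW w.
Proof.
move=> Ww; have [wj|wj] := alpha_rho_cases based j (weyl_inv Phi_root Ww).
  by rewrite ltNge (ltW wj) /= scale0r addr0 -Tw_ascr.
rewrite wj (Tw_descr Ww wj).
by rewrite -mulrA T_sqr mulrDr mulr1 addrC scalerAr.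
Qed.

Lemma Tw_mulrV j w : W w -> TW w * (T j)^-1 = TW (w \o sigma j)%VF -
  (if 0 < alpha j ((w^-1)%VF rho) then tdiff j else 0) *: TW w.
Proof.
move=> Ww; rewrite T_inv mulrBr mulr_algr Tw_mulr // -addrA -scalerBl.
have [wj|wj] := alpha_rho_cases based j (weyl_inv Phi_root Ww).
  by rewrite wj ltNge (ltW wj) /= sub0r scaleNr.
by rewrite wj ltNge (ltW wj) /= subrr scale0r subr0 addr0.
Qed.

(** * Antisymmetrizers of the stabilizers *)

Section Stabilizer.
Context (c : E) (c_dominant : forall j, 0 <= alpha j c).

Local Notation Wc := (stab dot Phi c).
Local Notation w0c := (longest dot alpha Wc).
Local Notation antisym_c := (antisym dot alpha t T Wc).

Let Wc_fin : finite_set Wc. Proof. exact: (stab_finite based). Qed.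

(** Reindexing by w -> s_j w the part of T_j 1^- that involves T_(s_j w) collects the coefficient of
    each T_w, which is then computed according to whether s_j w is longer than w. *)
Lemma antisym_mull j : alpha j c = 0 -> T j * antisym_c = - (tj j)^-1 *: antisym_c.
Proof.
move=> jc; have tj0 := tj_neq0 j.
pose G w := ((-1) ^+ len w * (tW w)^-1) *: TW (sigma j \o w)%VF.
have GE w : Wc w -> ((-1) ^+ len (sigma j \o w)%VF * (tW (sigma j \o w)%VF)^-1) *: TW w =
  G (sigma j \o w)%VF by move=> Wcw; rewrite /G (sigmaKl based).
rewrite /antisym mulr_fsumr_fin // scaler_fsum //.
under eq_fsbigr => w /set_mem[Ww _].
  rewrite -scalerAr Tw_mull // scalerDr scalerA -[_ *: TW (_ \o _)%VF]/(G w).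
  over.
rewrite fsbig_split // (sum_stab_mull based _ (stab_sigma based jc)) -fsbig_split //.
apply: eq_fsbigr => w /set_mem[Ww _].
rewrite /G (sigmaKl based) /= -scalerDl scalerA; congr (_ *: _).
rewrite (sign_sigmal based) //; have t0 := tW_neq0 w.
have [wj|wj] := alpha_rho_cases based j Ww.
  rewrite ltNge (ltW wj) /= mulr0 addr0 tW_asc //.
  move: (tj j) (tW w) ((-1) ^+ len w) tj0 t0 => p q s p0 q0.
  by field; rewrite p0 q0.
have {}t0 := tW_neq0 (sigma j \o w)%VF; rewrite wj (tW_desc Ww wj) /tdiff.
move: (tj j) (tW _) ((-1) ^+ len w) tj0 t0 => p q s p0 q0.
by field; rewrite ?p0 ?q0.
Qed.

Lemma Tw_antisym v : Wc v -> TW v * antisym_c = ((-1) ^+ len v * (tW v)^-1) *: antisym_c.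
Proof.
move: v; apply: (stab_ind based c_dominant) => [|j v [Wv _] jc vj IH].
  by rewrite (len0 based) tW1 Tw1 mul1r invr1 mulr1 scale1r.
rewrite (Tw_asc Wv vj) -mulrA IH -scalerAr antisym_mull //.
rewrite scalerA (sign_sigmal based) // tW_asc // invfM; congr (_ *: _).
by move: ((-1) ^+ len v) (tW v)^-1 (tj j)^-1 => s p q; ring.
Qed.

(** Here u is any element of W: the lengths need not add, but their parities do. *)
Lemma sign_comp_stab u v : W u -> Wc v ->
  (-1) ^+ len (u \o v)%VF = (-1) ^+ (len u + len v) :> F.
Proof.
move=> Wu; move: v; apply: (stab_indr based c_dominant) => [|j v [Wv _] jc vj IH].
  by rewrite comp_lfun1r (len0 based) addn0.
rewrite comp_lfunA (sign_sigmar based) ?IH; last exact: weyl_comp.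
by rewrite (len_ascr based) // addnS exprS mulN1r.
Qed.

(* Multiplying on the left by [T_(w0c)] turns [(T_(v^-1))^-1] into [T_(w0c v)],
   so the sum becomes a multiple of the antisymmetrizer, on which [T_(w0c)]
   acts by a scalar. *)
Lemma antisym_inv : \sum_(v \in Wc) ((-1) ^+ len v * tW v) *: (TW (v^-1)%VF)^-1 =
  tW w0c ^+ 2 *: antisym_c.
Proof.
have [Wcw0 _] := longest_stab based c; have Ww0 := stab_weyl Wcw0.
have t0 := tW_neq0.
have desc := longest_descr based (c := c).
apply: (mulrI (Tw_unit w0c)); rewrite -scalerAr Tw_antisym // scalerA.
rewrite mulr_fsumr_fin // /antisym [X in _ *: X](sum_stab_mull based _ Wcw0).
rewrite scaler_fsum //.
apply: eq_fsbigr => v /set_mem Wcv; have Wv := stab_weyl Wcv.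
have wvE : TW (w0c \o v)%VF * TW (v^-1)%VF = TW w0c.
  exact: (rprod_comp_stab_desc based c_dominant T_braid Ww0 desc Wcv).
have tvE : tW (w0c \o v)%VF * tW v = tW w0c.
  rewrite -[X in _ * X]tW_inv //.
  exact: (rprod_comp_stab_desc based c_dominant t_braid Ww0 desc Wcv).
rewrite -scalerAr -[TW w0c]wvE mulrK ?Tw_unit // scalerA -tvE.
congr (_ *: _); rewrite sign_comp_stab // exprD.
have sgn : (-1) ^+ len w0c * (-1) ^+ len w0c = 1 :> F by rewrite -expr2 sqrr_sign.
move: sgn ((-1) ^+ len v) (tW v) (tW (w0c \o v)%VF) (t0 v) (t0 (w0c \o v)%VF).
move: ((-1) ^+ len w0c) => s ss q p p' p0 p'0.
transitivity (s * s * (q * p)); first by rewrite ss mul1r.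
by field; rewrite ?p0 ?p'0.
Qed.

End Stabilizer.

(** * Normal forms with coefficients in F[Lambda] on the left *)

Lemma embed_linear (a : F) f g : embed X (a *: f + g) = a *: embed X f + embed X g.
Proof. exact: linearP. Qed.

Lemma embed_T j f : supported Lambda f ->
  T j * embed X f = embed X (wact (sigma j) f) * T j + tdiff j *: embed X (nabla j f).
Proof.
move: f; apply: supported_ind => [|a y f Ly Lf IH].
  by rewrite (nabla0 based) !linear0 mulr0 mul0r ?scaler0 addr0.
have L1 := @supported_basis R E F _ _ Ly.
have wP g1 g2 : wact (sigma j) (a *: g1 + g2) =
  a *: wact (sigma j) g1 + wact (sigma j) g2 by exact: linearP.
rewrite (nabla_linear based Lambda_adm _ _ L1 Lf) wP !embed_linear mulrDr IH mulrDl.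
rewrite -scalerAl -scalerAr scalerDr !scalerA [tdiff j * a]mulrC -!scalerA.
rewrite addrACA -scalerDr wact_basis !embed_basis; congr (_ *: _ + _).
have [_ _ _ _ /(_ j y Ly) /eqP] := relations.
by rewrite subr_eq addrC => /eqP.
Qed.

Implicit Types d : 'End(E) -> {malg F[E]}.

(** Reads a family of coefficients as an element of the Hecke algebra; [hsum_inj] below recovers the
    coefficients on W. *)
Definition hsum d : H :=
  \sum_(u \in W) embed X (d u) * TW u.

(** The coefficient of T_u in T_j times [hsum d]. Moving T_j past d v gives s_j(d v) T_j and a nabla
    term. The product T_j T_v then contributes at s_j v, which is the first summand, and also at v
    if j is a left descent of v, which is the second. *)
Definition coefT j d u : {malg F[E]} :=
  wact (sigma j) (d (sigma j \o u)%VF) +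
  ((if alpha j (u rho) < 0 then tdiff j else 0) *: wact (sigma j) (d u) +
   tdiff j *: nabla j (d u)).

Let W_fin : finite_set W. Proof. exact: weyl_finite Phi_root. Qed.

Lemma sum_weyl_mull (V : nmodType) (G : 'End(E) -> V) u : W u ->
  \sum_(v \in W) G v = \sum_(v \in W) G (u \o v)%VF.
Proof. by rewrite -(stab0 dot Phi); apply: (sum_stab_mull based). Qed.

Lemma sum_weyl_mulr (V : nmodType) (G : 'End(E) -> V) u : W u ->
  \sum_(v \in W) G v = \sum_(v \in W) G (v \o u)%VF.
Proof. by rewrite -(stab0 dot Phi); apply: (sum_stab_mulr based). Qed.

Definition coef_supported d :=
  forall u, W u -> supported Lambda (d u).

Lemma supported_sigma j f : supported Lambda f -> supported Lambda (wact (sigma j) f).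
Proof. by apply: (supported_weyl Lambda_adm); apply: (W_sigma based). Qed.

Lemma T_hsum j d : coef_supported d -> T j * hsum d = hsum (coefT j d).
Proof.
move=> Ld; rewrite /hsum mulr_fsumr_fin //.
pose G u := embed X (wact (sigma j) (d u)) * TW (sigma j \o u)%VF.
pose G' u := embed X ((if alpha j (u rho) < 0 then tdiff j else 0) *:
  wact (sigma j) (d u) + tdiff j *: nabla j (d u)) * TW u.
transitivity (\sum_(u \in W) (G u + G' u)).
  apply: eq_fsbigr => u /set_mem Wu; rewrite mulrA embed_T; last exact: Ld.
  rewrite mulrDl -mulrA Tw_mull // mulrDr -addrA; congr (_ + _).
  by rewrite /G' linearD !linearZ /= mulrDl -!scalerAl -scalerAr.
rewrite fsbig_split // (sum_weyl_mull G (W_sigma based j)) -fsbig_split //.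
apply: eq_fsbigr => u _; rewrite /G /G' (sigmaKl based) /= -mulrDl.
by rewrite -linearD.
Qed.

Lemma coefT_supported j d : coef_supported d -> coef_supported (coefT j d).
Proof.
move=> Ld u Wu; have Wju := W_sigmal based j Wu.
apply: supportedD; first exact/supported_sigma/Ld.
apply: supportedD; apply: supportedZ; first exact/supported_sigma/Ld.
by apply: (supported_nabla based Lambda_adm); apply: Ld.
Qed.

(** Triangularity is recorded by length only, which is enough to isolate the coefficient at the
    longest element. *)
Lemma Tw_embed f w : supported Lambda f -> W w ->
  exists d, [/\ coef_supported d, TW w * embed X f = hsum d, d w = wact w f
    & forall u, W u -> d u != 0 -> u = w \/ (len u < len w)%N].
Proof.
move=> Lf; rewrite -{1}(stab0 dot Phi).
move: w; apply: (stab_ind based) => [j||j w [Ww _] _ wj [d [Ld dE dw d0]]].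
- by rewrite linear0.
- exists (fun u => if u == \1%VF then f else 0); split=> [u _|||u _].
  + by case: eqP => _ //; exact: supported0.
  + rewrite Tw1 mul1r /hsum (fsbigD1 (\1%VF : 'End(E))) //=; last exact: weyl1.
    rewrite eqxx Tw1 mulr1 fsbig1 ?addr0 // => u [_ /eqP /negPf ->].
    by rewrite linear0 mul0r.
  + by rewrite eqxx wact_id.
  + by case: (u =P \1%VF) => [->|_]; [left | rewrite eqxx].
exists (coefT j d); have len_jw := len_asc based Ww wj.
have Wjw := W_sigmal based j Ww.
have djw : d (sigma j \o w)%VF = 0.
  apply/eqP; apply: contraT => /(d0 _ Wjw)[/(congr1 len)|]; rewrite len_jw.
    by move/eqP; rewrite eqn_leq ltnn.
  by rewrite ltnNge leqnSn.
split=> [|||u Wu].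
- exact: coefT_supported.
- by rewrite (Tw_asc Ww wj) -mulrA dE T_hsum.
- rewrite /coefT (sigmaKl based) dw djw linear0 scaler0 (nabla0 based) scaler0.
  by rewrite !addr0 wact_comp.
have [dju|dju] := eqVneq (d (sigma j \o u)%VF) 0; last first.
  move=> _; have [<-|lju] := d0 _ (W_sigmal based j Wu) dju.
    by left; rewrite (sigmaKl based).
  right; rewrite len_jw; have := len_sigma_le based j (W_sigmal based j Wu).
  by rewrite (sigmaKl based) => /leq_ltn_trans; apply; rewrite ltnS.
have [du|du] := eqVneq (d u) 0.
  by rewrite /coefT dju du linear0 (nabla0 based) !scaler0 !addr0 eqxx.
by move=> _; right; rewrite len_jw ltnS; have [->//|/ltnW] := d0 _ Wu du.
Qed.

(** Only the term of w0 in 1^- reaches T_(w0): the coefficients of T_w f for w <> w0 can be nonzero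
    only at w or at shorter elements. *)
Lemma antisym_embed_exists f : supported Lambda f -> exists d,
  [/\ coef_supported d, antisym dot alpha t T W * embed X f = hsum d &
    d w0 = ((-1) ^+ len w0 * (tW w0)^-1) *: wact w0 f].
Proof.
move=> Lf; have W_w0 := W_w0 based.
have /choice [D DP] : forall w, exists d, W w -> [/\ coef_supported d,
    TW w * embed X f = hsum d, d w = wact w f
    & forall u, W u -> d u != 0 -> u = w \/ (len u < len w)%N].
  move=> w; have [Ww|nW] := pselect (W w); last by exists (fun=> 0).
  by have [d dP] := Tw_embed Lf Ww; exists d.
pose s w := (-1) ^+ len w * (tW w)^-1.
exists (fun u => \sum_(w \in W) s w *: D w u); split.
- move=> u Wu; rewrite fsbig_finite //; apply: supported_sum => w.
  rewrite in_fset_set // inE => Ww; apply: supportedZ.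
  by have [LD _ _ _] := DP w Ww; apply: LD.
- rewrite /antisym mulr_fsuml_fin // /hsum.
  transitivity (\sum_(w \in W) \sum_(u \in W) s w *: (embed X (D w u) * TW u)).
    apply: eq_fsbigr => w /set_mem Ww; have [_ DE _ _] := DP w Ww.
    by rewrite -scalerAl DE /hsum scaler_fsum.
  rewrite exchange_fsbig //; apply: eq_fsbigr => u _.
  rewrite !(fsbig_finite _ _ W_fin) raddf_sum mulr_suml; apply: eq_bigr => w _ /=.
  by rewrite [embed X (_ *: _)]linearZ /= scalerAl.
rewrite (fsbigD1 w0) //= fsbig1 ?addr0 => [|w [Ww ww0]].
  by have [_ _ -> _] := DP _ W_w0.
have [_ _ _ D0] := DP w Ww; have [->|/(D0 _ W_w0)[/esym//|]] := eqVneq (D w w0) 0.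
  by rewrite scaler0.
by rewrite ltnNge (w0_max based Ww).
Qed.

Definition iota_w0 f : {malg F[E]} := iota_inv (wact w0 f).

Lemma iota_w0_linear (a : F) f g : iota_w0 (a *: f + g) = a *: iota_w0 f + iota_w0 g.
Proof. by rewrite /iota_w0 !linearP. Qed.

Lemma supported_iota_w0 f : supported Lambda f -> supported Lambda (iota_w0 f).
Proof.
move=> Lf; apply: (supported_lattice_iota Lambda_adm).
exact: (supported_weyl Lambda_adm (W_w0 based)).
Qed.

Lemma iota_w0Z (a : F) f : iota_w0 (a *: f) = a *: iota_w0 f.
Proof. by rewrite -[a *: f]addr0 iota_w0_linear /iota_w0 !linear0 addr0. Qed.

(** Invariance under w0 compares alpha_j with - alpha_k, and invariance under s_k compares - alpha_k
    with alpha_k. *)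
Lemma t_w0 j k : (alpha j \o w0)%VF = - alpha k -> tj k = tj j.
Proof.
move=> jk; have tW_inv := t_inv.2.
rewrite -(tW_inv _ _ (W_sigma based k) (alpha_root based k)) (alpha_sigma based).
by rewrite -jk (tW_inv _ _ (W_w0 based) (alpha_root based j)).
Qed.

Lemma pi_T_iota_w0 j k f : (alpha j \o w0)%VF = - alpha k -> supported Lambda f ->
  pi (T j) (iota_w0 f) = iota_w0 (pi (T k) f).
Proof.
move=> jk Lf; rewrite (pi_T j (supported_iota_w0 Lf)) (pi_T k Lf).
rewrite iota_w0_linear iota_w0Z /tdiff (t_w0 jk).
rewrite /iota_w0 (nabla_iota_w0 based Lambda_adm jk Lf) -iota_wact !wact_comp.
by rewrite (w0_sigma based jk).
Qed.

(** * The action on quasi-polynomials *)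

Context (piqp : H -> {malg F[E]} -> {malg F[E]}).
Context (piqp_rep : quasi_polynomial_rep dot alpha t Lambda T X piqp).

Lemma piqp_linearr h (a : F) f g : piqp h (a *: f + g) = a *: piqp h f + piqp h g.
Proof. by case: piqp_rep => -[_ + _ _ _] _ _; apply. Qed.

Lemma piqp_linearl (a : F) h h' f : piqp (a *: h + h') f = a *: piqp h f + piqp h' f.
Proof. by case: piqp_rep => -[_ _ + _ _] _ _; apply. Qed.

Lemma piqpM h h' f : piqp (h * h') f = piqp h (piqp h' f).
Proof. by case: piqp_rep => -[_ _ _ _ +] _ _; apply. Qed.

Lemma piqp1 f : piqp 1 f = f.
Proof. by case: piqp_rep => -[_ _ _ + _] _ _; apply. Qed.

Lemma piqpDl h h' f : piqp (h + h') f = piqp h f + piqp h' f.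
Proof. by rewrite -[h]scale1r piqp_linearl !scale1r. Qed.

Lemma piqp0l f : piqp 0 f = 0.
Proof. by apply: (addrI (piqp 0 f)); rewrite -piqpDl !addr0. Qed.

Lemma piqpZl (a : F) h f : piqp (a *: h) f = a *: piqp h f.
Proof. by rewrite -[a *: h]addr0 piqp_linearl piqp0l addr0. Qed.

Lemma piqp0r h : piqp h 0 = 0.
Proof.
have := piqp_linearr h 1 0 0; rewrite !scale1r addr0 => /eqP.
by rewrite -subr_eq0 opprD addrA subrr add0r oppr_eq0 => /eqP.
Qed.

Lemma piqpZr h (a : F) f : piqp h (a *: f) = a *: piqp h f.
Proof. by rewrite -[a *: f]addr0 piqp_linearr piqp0r addr0. Qed.

Lemma piqp_sum (I : choiceType) (P : set I) (G : I -> H) f : finite_set P ->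
  piqp (\sum_(i \in P) G i) f = \sum_(i \in P) piqp (G i) f.
Proof.
move=> Pfin; rewrite !fsbig_finite //.
by apply: (big_morph (piqp^~ f)) => [h h'|]; [exact: piqpDl | exact: piqp0l].
Qed.

Lemma piqp_embed f g : supported Lambda f -> piqp (embed X f) g = gmul f g.
Proof.
move=> Lf; move: f Lf; apply: supported_ind => [|a y f Ly _ IH].
  by rewrite linear0 piqp0l gmul0l.
suff Xy : piqp (X y) g = gmul << y >> g.
  by rewrite embed_linear piqp_linearl IH gmulDl gmulZl embed_basis Xy.
move: g {IH} (@supportedT _ _ _ g); apply: supported_ind => [|b z g _ _ IHg].
  by rewrite piqp0r linear0.
rewrite piqp_linearr IHg linearP /= gmul_basis.
by case: piqp_rep => _ Xyz _; rewrite Xyz.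
Qed.

Lemma gdiv0 j : gdiv 0 (den dot alpha F j) = 0.
Proof. by apply: gdivP; [exact: (coroot_alpha_neq0 based) | exact: gmul0l]. Qed.

(** The floor is 0, which kills the difference quotient, and a number strictly between 0 and 1 is
    not an integer, so [chi] is 1. *)
Lemma piqp_T_alcove j y : 0 < alpha j y < 1 -> piqp (T j) << y >> = << (sigma j y) >>.
Proof.
move=> /andP[jy0 jy1]; have [_ _ ->] := piqp_rep.
have -> : Num.floor (alpha j y : R) = 0.
  by apply: floor_def; rewrite (ltW jy0) add0r.
rewrite mulr0z subr0 subrr gdiv0 scaler0 addr0 /chi.
case: ifP => [/intrP[m jm]|_]; last by rewrite scale1r.
by move: jy0 jy1; rewrite jm ltr0z ltrz1; lia.
Qed.

Lemma piqp_T_fixed j y : alpha j y = 0 -> piqp (T j) << y >> = tj j *: << y >>.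
Proof.
move=> jy; have [_ _ ->] := piqp_rep.
rewrite /chi jy floor0 mulr0z subr0 subrr gdiv0 scaler0 addr0 rpred0.
by rewrite /srefl reflE jy scale0r subr0.
Qed.

Section AlcovePoint.
Context (c : E) (c_C0 : C0 dot alpha Phi Lambda c).

Local Notation Wc := (stab dot Phi c).
Local Notation Wmin := (min_reps dot alpha Phi c).

Let c_dominant := C0_dominant based c_C0.

(** At each letter of a reduced word, alpha_j \o w is a positive root not vanishing at c, so alpha_j
    (w c) lies strictly between 0 and 1 and T_j acts as s_j. *)
Lemma piqp_Tw_min w : Wmin w -> piqp (TW w) << c >> = << (w c) >>.
Proof.
move=> wm; have := min_reps_weyl wm; rewrite -(stab0 dot Phi) => Ww.
move: w Ww wm; apply: (stab_ind based) => [j|_|j w [Ww _] _ wj IH jwm].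
- by rewrite linear0.
- by rewrite Tw1 piqp1 id_lfunE.
rewrite (Tw_asc Ww wj) piqpM IH; last exact: (min_reps_sigma based Ww wj).
rewrite piqp_T_alcove ?comp_lfunE // -comp_lfunE.
apply: (C0_root based Lambda_adm c_C0).
  by apply/(pos_rho based); rewrite ?comp_lfunE //; apply: (root_alpha_weyl based).
by rewrite comp_lfunE; apply: (min_reps_sigma_neq0 based Ww wj).
Qed.

Lemma piqp_Tw_stab v : Wc v -> piqp (TW v) << c >> = tW v *: << c >>.
Proof.
move: v; apply: (stab_indr based c_dominant) => [|j v [Wv _] jc vj IH].
  by rewrite Tw1 piqp1 tW1 scale1r.
rewrite (Tw_ascr Wv vj) piqpM piqp_T_fixed // piqpZr IH scalerA tW_ascr //.
by rewrite mulrC.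
Qed.

Lemma piqp_Tw_comp w v : Wmin w -> Wc v ->
  piqp (TW (w \o v)%VF) << c >> = tW v *: << (w c) >>.
Proof.
move=> wm Wcv; have Ww := min_reps_weyl wm.
have -> : TW (w \o v)%VF = TW w * TW v.
  apply: (rprod_comp_stab based c_dominant T_braid Ww) Wcv => j.
  exact: (min_reps_asc based).
by rewrite piqpM piqp_Tw_stab // piqpZr piqp_Tw_min.
Qed.

(** If w c and u c lie in the same coset of Lambda they are equal, so w and u represent the same
    coset of W_c and coincide by minimality. *)
Lemma min_reps_free (d : 'End(E) -> {malg F[E]}) :
  (forall w, Wmin w -> supported Lambda (d w)) ->
  \sum_(w \in Wmin) gmul (d w) << (w c) >> = 0 ->
  forall w, Wmin w -> d w = 0.
Proof.
move=> Ld sum0; apply: (coset_free (S := Lambda) (b := fun w : 'End(E) => w c)) => //.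
- exact: (latticeB Lambda_adm).
- exact: (min_reps_finite based).
move=> w u wm um Lwu; have Ww := min_reps_weyl wm; have Wu := min_reps_weyl um.
have wu := C0_coset based Lambda_adm c_C0 Ww Wu Lwu.
have Wcu : Wc (u^-1 \o w)%VF.
  split; first by apply: weyl_comp => //; apply: (weyl_inv Phi_root).
  by rewrite comp_lfunE wu (weylK Phi_root Wu).
have := min_reps_unique based c_dominant wm um (stab1 _ _ _) Wcu.
by case=> //; rewrite comp_lfun1r comp_lfunA (weyl_compwV Phi_root Wu) comp_lfun1l.
Qed.

(** [gamma] is some chosen decomposition; freeness makes any two agree on W^c, so exhibiting one
    decomposition computes it. *)
Lemma gamma_unique f d : gamma_decomposition dot Phi alpha Lambda c f d ->
  forall w, Wmin w -> gamma dot Phi alpha Lambda c f w = d w.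
Proof.
move=> dP w wm; have : gamma_decomposition dot Phi alpha Lambda c f
    (gamma dot Phi alpha Lambda c f).
  apply: (@xgetPex _ (fun=> 0)
    [set g | gamma_decomposition dot Phi alpha Lambda c f g]).
  by exists d.
move: (gamma _ _ _ _ _ _) => e [Le fe]; have [Ld fd] := dP.
apply/eqP; rewrite -subr_eq0; apply/eqP; move: w wm.
apply: min_reps_free => [w wm|]; first by apply: supportedB; [exact: Le | exact: Ld].
have Wm_fin := min_reps_finite based c.
transitivity (\sum_(w \in Wmin) (gmul (e w) << (w c) >> - gmul (d w) << (w c) >>)).
  by apply: eq_fsbigr => w _; rewrite gmulBl.
by rewrite fsbig_finite // sumrB -!(fsbig_finite _ _ Wm_fin) -fe -fd subrr.
Qed.

End AlcovePoint.

Lemma hsum_inj d d' : coef_supported d -> coef_supported d' -> hsum d = hsum d' ->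
  forall u, W u -> d u = d' u.
Proof.
move=> Ld Ld' dd' u Wu; have [c Cc c1] := regular_C0_exists based Lambda_adm.
have Wmin : min_reps dot alpha Phi c = W.
  apply/seteqP; split=> w; [by case | move=> Ww; split=> // v /c1 ->].
  by rewrite comp_lfun1r.
have hc e : coef_supported e ->
    piqp (hsum e) << c >> = \sum_(w \in min_reps dot alpha Phi c) gmul (e w) << (w c) >>.
  move=> Le; rewrite /hsum piqp_sum // Wmin; apply: eq_fsbigr => w /set_mem Ww.
  by rewrite piqpM (piqp_Tw_min Cc) ?Wmin // piqp_embed //; apply: Le.
have ge : gamma_decomposition dot Phi alpha Lambda c (piqp (hsum d) << c >>) d.
  by split; [rewrite Wmin | exact: hc].
have ge' : gamma_decomposition dot Phi alpha Lambda c (piqp (hsum d) << c >>) d'.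
  by split; [rewrite Wmin | rewrite dd'; exact: hc].
by rewrite -(gamma_unique Cc ge) ?(gamma_unique Cc ge') ?Wmin.
Qed.

(** The linear algebra of the recursion, with p = t_j, q = t_j^-1, x the unknown coefficient at u, e
    the known one at s_j u, n = nabla_j e and s = s_j e; then p s + (p - q) n is pi(T_j) e. *)
Lemma eigen_recursion (V : lmodType F) (p q : F) (x e n s : V) :
  x + ((p - q) *: e + (p - q) *: (n + (s - e))) = - q *: s ->
  x = - (p *: s + (p - q) *: n).
Proof.
rewrite -scalerDr [n + _]addrC addrA [e + _]addrC subrK scalerDr scaleNr.
move=> /(canRL (addrK _)) ->; rewrite -opprD addrA; congr (- (_ + _)).
by rewrite -scalerDl addrC subrK.
Qed.

(** * The coefficients of 1^- f and of its right multiples *)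

Section Fixed.
Context (f : {malg F[E]}) (Lf : supported Lambda f).

Let Lif : supported Lambda (iota_inv f).
Proof. exact: (supported_lattice_iota Lambda_adm). Qed.

Lemma antisym_embed : antisym dot alpha t T W * embed X f =
  hsum (fun u => ((-1) ^+ len u * (tW w0)^-1) *:
                 iota_w0 (pi (TW (w0 \o u)%VF) (iota_inv f))).
Proof.
have [d [Ld dE dw0]] := antisym_embed_exists Lf; have W_w0 := W_w0 based.
have w0K := w0_involutive based.
have Lneg (a : F) : coef_supported (fun u => a *: d u).
  by move=> u Wu; apply: supportedZ; apply: Ld.
have Tneg j : hsum (coefT j d) = hsum (fun u => - (tj j)^-1 *: d u).
  have neg : T j * antisym dot alpha t T W = - (tj j)^-1 *: antisym dot alpha t T W.
    by rewrite -(stab0 dot Phi); apply: antisym_mull; exact: linear0.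
  rewrite -T_hsum // -dE mulrA neg -scalerAl dE /hsum scaler_fsum //.
  by apply: eq_fsbigr => u _; rewrite scalerAl [embed X (_ *: _)]linearZ.
have rec j u : W u -> 0 < alpha j (u rho) ->
    d u = - pi (T j) (d (sigma j \o u)%VF).
  move=> Wu uj; have Wju := W_sigmal based j Wu.
  (* Coefficients are compared at s_j u, for which j is a descent; there d u occurs only as s_j(d
     u), and applying s_j frees it. *)
  have := hsum_inj (coefT_supported Ld) (Lneg _) (Tneg j) Wju.
  rewrite /coefT (sigmaKl based) (alpha_sigma_rho based) oppr_lt0 uj.
  rewrite pi_T; last exact: Ld.
  set e := d (sigma j \o u)%VF => /(congr1 (wact (sigma j))).
  have Le : supported Lambda e by apply: Ld.
  have Ws (a : F) g g' : wact (sigma j) (a *: g + a *: g') =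
      a *: wact (sigma j) g + a *: wact (sigma j) g'.
    by rewrite -!scalerDr -linearD; exact: linearZ.
  rewrite linearD /= Ws linearZ /= !wact_comp (sigmaK based) !wact_id.
  by rewrite (sigma_nabla based Lambda_adm j Le) => /eigen_recursion.
(* Indexing by w0 u turns the descent from w0 into an induction on u that starts at the known
   coefficient d w0. *)
have dE' u : W u -> d (w0 \o u)%VF = ((-1) ^+ len (w0 \o u)%VF * (tW w0)^-1) *:
    iota_w0 (pi (TW u) (iota_inv f)).
  rewrite -{1}(stab0 dot Phi).
  move: u; apply: (stab_ind based) => [j||k u [Wu _] _ uk IH].
  - by rewrite linear0.
  - have fE : iota_w0 (iota_inv f) = wact w0 f.
      by rewrite /iota_w0 -iota_wact iota_invK.
    by rewrite comp_lfun1r dw0 Tw1 (pi1 Lif) fE.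
  (* j is the index for which w0 s_k = s_j w0, so lengthening u by s_k shortens w0 u by s_j. *)
  have [j kj] := w0_alpha based k.
  have jk : (alpha j \o w0)%VF = - alpha k.
    apply/eqP; rewrite -eqr_oppLR -comp_lfunNl -kj -comp_lfunA w0K.
    by rewrite comp_lfun1r.
  have w0ku : (w0 \o (sigma k \o u))%VF = (sigma j \o (w0 \o u))%VF.
    exact: (w0_sigma_comp based).
  have Wku := W_sigmal based k Wu; have Ww0u := weyl_comp W_w0 Wu.
  have asc : 0 < alpha j ((w0 \o (sigma k \o u))%VF rho).
    have -> : alpha j ((w0 \o (sigma k \o u))%VF rho) =
        (alpha j \o w0)%VF ((sigma k \o u)%VF rho) by rewrite !comp_lfunE.
    by rewrite jk opp_lfunE (alpha_sigma_rho based) opprK.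
  have Lpi := supported_pi (h := TW u) Lif; have Liw := supported_iota_w0 Lpi.
  rewrite (rec j _ (weyl_comp W_w0 Wku) asc) w0ku (sigmaKl based) IH.
  rewrite (sign_sigmal based F j Ww0u) (piZr _ _ Liw) (pi_T_iota_w0 jk Lpi).
  by rewrite (Tw_asc Wu uk) (piM _ _ Lif) mulNr scaleNr.
rewrite dE /hsum; apply: eq_fsbigr => u /set_mem Wu.
have -> : d u = d (w0 \o (w0 \o u))%VF by rewrite comp_lfunA w0K comp_lfun1l.
by rewrite (dE' _ (weyl_comp W_w0 Wu)) [in len _]comp_lfunA w0K comp_lfun1l.
Qed.

(** At h = 1 this is t(w0) times 1^- f, by [antisym_embed]. The argument h absorbs what
    multiplication by T_j on the right does to the coefficients. *)
Definition twisted_sum h : H := \sum_(u \in W) (-1) ^+ len u *: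
  (embed X (iota_w0 (pi (TW (w0 \o u)%VF * h) (iota_inv f))) * TW u).

(** T_u T_j has the extra term (t_j - t_j^-1) T_u when j is a right descent of u, and T_(w0 u)
    T_j^-1 has the opposite extra term when j is a right ascent of w0 u. These conditions are
    equivalent, and the main terms match, up to sign, after replacing u by u s_j. *)
Lemma twisted_sum_mulT h j : twisted_sum h * T j = - twisted_sum ((T j)^-1 * h).
Proof.
pose N h' := embed X (iota_w0 (pi h' (iota_inv f))).
have ND (a : F) h1 h2 : N (h1 - a *: h2) = N h1 - a *: N h2.
  rewrite /N -scaleNr addrC pi_linearl // iota_w0_linear embed_linear.
  by rewrite addrC scaleNr.
have W_w0 := W_w0 based.
pose q u := if alpha j ((u^-1)%VF rho) < 0 then tdiff j else 0.
pose A u := (-1) ^+ len u *: (N (TW (w0 \o u)%VF * h) * TW (u \o sigma j)%VF).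
pose B u := (-1) ^+ len u *: (q u *: (N (TW (w0 \o u)%VF * h) * TW u)).
rewrite /twisted_sum mulr_fsuml_fin //.
transitivity (\sum_(u \in W) (A u + B u)).
  apply: eq_fsbigr => u /set_mem Wu; rewrite -scalerAl -mulrA Tw_mulr //.
  by rewrite mulrDr -scalerAr scalerDr.
rewrite fsbig_split // (sum_weyl_mulr A (W_sigma based j)) -fsbig_split //.
rewrite -[RHS]scaleN1r scaler_fsum //; apply: eq_fsbigr => u /set_mem Wu /=.
rewrite /A /B (sigmaKr based) (sign_sigmar based) // mulrA Tw_mulrV; last exact: weyl_comp.
rewrite (w0_comp_asc based j Wu) mulrBl -scalerAl -[embed X _]/(N _) ND -/(q u).
rewrite mulrBl -scalerAl.
by rewrite scaleN1r scalerBr opprB addrC scaleNr comp_lfunA.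
Qed.

Lemma twisted_sum_mul w : W w ->
  twisted_sum 1 * TW w = (-1) ^+ len w *: twisted_sum ((TW w)^-1).
Proof.
rewrite -{1}(stab0 dot Phi).
move: w; apply: (stab_indr based) => [j||j w [Ww _] _ wj IH].
- by rewrite linear0.
- by rewrite Tw1 mulr1 invr1 (len0 based) scale1r.
rewrite (Tw_ascr Ww wj) mulrA IH -scalerAl twisted_sum_mulT.
by rewrite (sign_sigmar based F j Ww) (invrM (Tw_unit w) (T_unit j)) scalerN scaleNr.
Qed.

Lemma antisym_embed_Tw w : W w -> antisym dot alpha t T W * embed X f * TW w =
  ((tW w0)^-1 * (-1) ^+ len w) *: twisted_sum ((TW w)^-1).
Proof.
move=> Ww; rewrite -scalerA -twisted_sum_mul // scalerAl; congr (_ * _).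
rewrite antisym_embed /twisted_sum scaler_fsum //; apply: eq_fsbigr => u _.
by rewrite mulr1 [embed X (_ *: _)]linearZ /= -scalerAl scalerA mulrC.
Qed.

End Fixed.

(** t(v) comes from the action of T_(w v) on x^c. The inverse of T_(v^-1) comes from T_(w0 w v),
    since the simple reflections of W_c, ascents of w on the right, are descents of w0 w. Both are
    placed inside [pi] so that the sum over v can be taken there. *)
Lemma antisym_term c f h w v : supported Lambda f -> C0 dot alpha Phi Lambda c ->
  min_reps dot alpha Phi c w -> stab dot Phi c v ->
  piqp ((-1) ^+ len (w \o v)%VF *:
    (embed X (iota_w0 (pi (TW (w0 \o (w \o v))%VF * h) f)) * TW (w \o v)%VF)) << c >> =
  (-1) ^+ len w *: gmul (iota_w0 (pi (TW (w0 \o w)%VF *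
    (((-1) ^+ len v * tW v) *: (TW (v^-1)%VF)^-1) * h) f)) << (w c) >>.
Proof.
move=> Lf Cc wm Wcv; have W_w0 := W_w0 based.
have c_dominant := C0_dominant based Cc; have Ww := min_reps_weyl wm.
have desc j : alpha j c = 0 -> alpha j (((w0 \o w)^-1)%VF rho) < 0.
  by move=> jc; apply: (w0_comp_desc based Ww); apply: (min_reps_asc based wm).
have TwE : TW (w0 \o (w \o v))%VF = TW (w0 \o w)%VF * (TW (v^-1)%VF)^-1.
  apply: (mulIr (Tw_unit (v^-1)%VF)); rewrite (mulrVK (Tw_unit _)) comp_lfunA.
  exact: (rprod_comp_stab_desc based c_dominant T_braid (weyl_comp W_w0 Ww) desc).
rewrite TwE -scalerAr -scalerAl (piZl _ _ Lf) iota_w0Z gmulZl.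
set Y := TW (w0 \o w)%VF * _ * h.
have LY : supported Lambda (iota_w0 (pi Y f)).
  by apply: supported_iota_w0; apply: supported_pi.
rewrite piqpZl piqpM (piqp_Tw_comp Cc wm Wcv) piqpZr (piqp_embed _ LY).
by rewrite !scalerA (min_reps_len based c_dominant wm Wcv) exprD mulrA.
Qed.

Lemma antisym_sum c f h w : supported Lambda f -> C0 dot alpha Phi Lambda c ->
  \sum_(v \in stab dot Phi c) gmul (iota_w0 (pi (TW (w0 \o w)%VF *
    (((-1) ^+ len v * tW v) *: (TW (v^-1)%VF)^-1) * h) f)) << (w c) >> =
  tW (longest dot alpha (stab dot Phi c)) ^+ 2 *: gmul (iota_w0 (pi
    (TW (w0 \o w)%VF * antisym dot alpha t T (stab dot Phi c) * h) f)) << (w c) >>.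
Proof.
move=> Lf Cc; have c_dominant := C0_dominant based Cc.
have Wc_fin := stab_finite based c.
(* The term as a linear function of the middle factor, which moves the sum over v inside, where
   [antisym_inv] evaluates it. *)
pose G (Y : H) := gmul (iota_w0 (pi (TW (w0 \o w)%VF * Y * h) f)) << (w c) >>.
have GP (a : F) Y Y' : G (a *: Y + Y') = a *: G Y + G Y'.
  rewrite /G mulrDr mulrDl -scalerAr -scalerAl (pi_linearl _ _ _ Lf).
  by rewrite iota_w0_linear gmulDl gmulZl.
have G0 : G 0 = 0 by rewrite -(subrr 0) -[X in G X]addrC -scaleN1r GP scaleN1r addNr.
have GD Y Y' : G (Y + Y') = G Y + G Y' by rewrite -[Y]scale1r GP !scale1r.
transitivity (\sum_(v \in stab dot Phi c)
    G (((-1) ^+ len v * tW v) *: (TW (v^-1)%VF)^-1)); first by [].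
rewrite fsbig_finite // -(big_morph G GD G0) -fsbig_finite // (antisym_inv c_dominant).
by rewrite -[_ *: _ as X in G X]addr0 GP G0 addr0.
Qed.

Lemma gamma_antisym c f w w' : C0 dot alpha Phi Lambda c ->
  min_reps dot alpha Phi c w' -> min_reps dot alpha Phi c w -> supported Lambda f ->
  gamma dot Phi alpha Lambda c
    (piqp (antisym dot alpha t T W * embed X f * TW w') << c >>) w =
  ((tW w0)^-1 * tW (longest dot alpha (stab dot Phi c)) ^+ 2 *
     (-1) ^+ (len w' + len w)%N) *:
    iota_w0 (pi (TW (w0 \o w)%VF * antisym dot alpha t T (stab dot Phi c) *
      (TW w')^-1) (iota_inv f)).
Proof.
move=> Cc wm' wm Lf; have Ww' := min_reps_weyl wm'.
have Lif := supported_lattice_iota Lambda_adm Lf.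
have c_dominant := C0_dominant based Cc; have Wc_fin := stab_finite based c.
have Wm_fin := min_reps_finite based c.
(* The claimed coefficients for all of W^c at once, because [gamma_unique] needs a whole
   decomposition. *)
pose d u := ((tW w0)^-1 * tW (longest dot alpha (stab dot Phi c)) ^+ 2 *
    (-1) ^+ (len w' + len u)) *: iota_w0 (pi
  (TW (w0 \o u)%VF * antisym dot alpha t T (stab dot Phi c) * (TW w')^-1) (iota_inv f)).
rewrite -[RHS]/(d w); apply: (gamma_unique Cc _ wm) => {w wm}; split=> [w wm|].
  by apply: supportedZ; apply: supported_iota_w0; apply: supported_pi.
rewrite (antisym_embed_Tw Lf Ww') piqpZl /twisted_sum (piqp_sum _ _ W_fin).
rewrite (sum_min_reps based c_dominant) (scaler_fsum _ _ Wm_fin).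
apply: eq_fsbigr => w /set_mem wm; rewrite /d gmulZl.
under eq_fsbigr => v /set_mem Wcv do rewrite (antisym_term _ Lif Cc wm Wcv).
rewrite -(scaler_fsum _ _ Wc_fin) (antisym_sum _ _ Lif Cc) !scalerA.
have coefE (p q s s' : F) : p * s' * s * q = p * q * (s' * s) by ring.
by rewrite exprD coefE.
Qed.

End HeckeAlgebra.

Theorem theorem5p3
  (R : realType) (E : vectType R) (dot : {dot E for idfun})
  (Phi : set 'Hom(E, R^o))
  (Phi_root : root_system dot Phi) (Phi_reduced : reduced_rs Phi)
  (Phi_irreducible : irreducible_rs dot Phi)
  (r : nat) (alpha : 'I_r -> 'Hom(E, R^o)) (alpha_simple : simple_roots Phi alpha)
  (F : fieldType) (t : 'Hom(E, R^o) -> F) (t_inv : W_invariant dot Phi t)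
  (Lambda : set E) (Lambda_adm : admissible_lattice dot Phi Lambda)
  (H : unitAlgType F) (T : 'I_r -> H) (X : E -> H)
  (H_hecke : ext_affine_hecke dot alpha t Lambda T X)
  (pi : H -> {malg F[E]} -> {malg F[E]})
  (pi_rep : polynomial_rep dot alpha t Lambda T X pi)
  (piqp : H -> {malg F[E]} -> {malg F[E]})
  (piqp_rep : quasi_polynomial_rep dot alpha t Lambda T X piqp)
  (c : E) (c_C0 : C0 dot alpha Phi Lambda c)
  (w' : 'End(E)) (w'_min : min_reps dot alpha Phi c w')
  (w : 'End(E)) (w_min : min_reps dot alpha Phi c w)
  (f : {malg F[E]}) (f_Lambda : supported Lambda f) :
  let W := weyl dot Phi in
  let Wc := stab dot Phi c in
  let l := len dot alpha in
  let w0 := longest dot alpha W in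
  gamma dot Phi alpha Lambda c
    (piqp (antisym dot alpha t T W * embed X f * Tw dot alpha T w') << c >>) w =
  ((tw dot alpha t w0)^-1 * tw dot alpha t (longest dot alpha Wc) ^+ 2 *
     (-1) ^+ (l w' + l w)%N) *:
    iota_inv (wact w0
      (pi (Tw dot alpha T (w0 \o w)%VF * antisym dot alpha t T Wc *
             (Tw dot alpha T w')^-1)
          (iota_inv f))).
Proof.
have based : based_root_system dot Phi alpha by [].
move: H_hecke => [relations _].
exact: (gamma_antisym based t_inv Lambda_adm relations pi_rep piqp_rep).
Qed.
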